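(* Assume Majority-QSETH (for $\textsc{maj-CNFSAT}$) holds. Then for each constant $\delta>0$ there is no bounded-error quantum algorithm that solves the strong simulation problem for quantum circuits on $n$ qubits up to $2$ bits of precision in $\mathcal{O}(2^{n(1-\delta)})$ time.
   Context: Strong simulation problem with $p$-bit precision ($p\in\mathbb{N}$): given a quantum circuit $C$ on $n$ qubits and $x\in\{0,1\}^n$, write $|\langle x|C|0^n\rangle|=C_0.C_1C_2\ldots$ in binary and output $C_0.C_1\ldots C_{p-1}$; for $p=2$ the output is $C_0.C_1$. A bounded-error quantum algorithm outputs a correct answer with probability at least $2/3$ on every input. $\textsc{maj-CNFSAT}$: given a CNF formula $\phi$ on $n$ variables, output $1$ if $\phi$ has at least $2^n/2$ satisfying assignments and $0$ otherwise. Majority-QSETH (for $\textsc{maj-CNFSAT}$) is the hypothesis: for each constant $\delta>0$ there exists $c>0$ such that there is no bounded-error quantum algorithm that solves $\textsc{maj-CNFSAT}$ (even restricted to formulas with $m\le cn^2$ clauses) in $\mathcal{O}(2^{n(1-\delta)})$ time. *)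

(* Defs.v *)
From Stdlib Require Import Reals List ListDec ZArith Arith Bool.
From Coquelicot Require Import Complex.
Import ListNotations.
Open Scope R_scope.

(** * Quantum circuits *)

(* A computational basis state of k qubits is a list of k bits, with qubit i at
   position i.  A state of k qubits is given by its amplitudes on these lists;
   its values on lists of other lengths are irrelevant. *)

Fixpoint bitstrings (k : nat) : list (list bool) :=
  match k with
  | O => [[]]
  | S k' => map (cons false) (bitstrings k') ++ map (cons true) (bitstrings k')
  end.

Definition bit (i : nat) (b : list bool) : bool := nth i b false.

Fixpoint set_bit (i : nat) (v : bool) (b : list bool) : list bool :=
  match b, i with
  | [], _ => []
  | _ :: b', O => v :: b'
  | a :: b', S i' => a :: set_bit i' v b'
  end.

Definition flip_bit (i : nat) (b : list bool) : list bool :=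
  set_bit i (negb (bit i b)) b.

Definition state : Type := list bool -> C.

Definition ket (b : list bool) : state :=
  fun b' => if list_eq_dec bool_dec b b' then RtoC 1 else RtoC 0.

Definition norm2 (k : nat) (psi : state) : R :=
  fold_right Rplus 0 (map (fun b => Cmod (psi b) ^ 2) (bitstrings k)).

(* The universal gate set Clifford+T (generated by H, T, CX), together with X
   and the Toffoli gate CCX.  The targets are the last arguments.  The type Q
   of qubit names is nat in circuits, and program variables in programs. *)
Inductive gate (Q : Type) : Type :=
| GH (i : Q)
| GT (i : Q)
| GX (i : Q)
| GCX (i j : Q)
| GCCX (i j l : Q).

Arguments GH {Q} i.
Arguments GT {Q} i.
Arguments GX {Q} i.
Arguments GCX {Q} i j.
Arguments GCCX {Q} i j l.

Definition gate_map {Q Q' : Type} (f : Q -> Q') (g : gate Q) : gate Q' :=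
  match g with
  | GH i => GH (f i)
  | GT i => GT (f i)
  | GX i => GX (f i)
  | GCX i j => GCX (f i) (f j)
  | GCCX i j l => GCCX (f i) (f j) (f l)
  end.

Definition gate_qubits {Q : Type} (g : gate Q) : list Q :=
  match g with
  | GH i | GT i | GX i => [i]
  | GCX i j => [i; j]
  | GCCX i j l => [i; j; l]
  end.

Definition gate_ok (k : nat) (g : gate nat) : Prop :=
  NoDup (gate_qubits g) /\ Forall (fun i => (i < k)%nat) (gate_qubits g).

Definition apply_gate (g : gate nat) (psi : state) : state := fun b =>
  match g with
  | GH i =>
      (RtoC (/ sqrt 2) * (psi (set_bit i false b)
         + (if bit i b then RtoC (-1) else RtoC 1) * psi (set_bit i true b)))%C
  | GT i => ((if bit i b then (cos (PI / 4), sin (PI / 4)) else RtoC 1) * psi b)%C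
  | GX i => psi (flip_bit i b)
  | GCX i j => psi (if bit i b then flip_bit j b else b)
  | GCCX i j l => psi (if bit i b && bit j b then flip_bit l b else b)
  end.

(* The head of the list is the gate applied first. *)
Definition circuit : Type := list (gate nat).

Definition circuit_ok (n : nat) (c : circuit) : Prop := Forall (gate_ok n) c.

Definition apply_circuit (c : circuit) (psi : state) : state :=
  fold_left (fun psi g => apply_gate g psi) c psi.

(* <x|c|0^n> *)
Definition amplitude (n : nat) (c : circuit) (x : list bool) : C :=
  apply_circuit c (ket (repeat false n)) x.

(** * Quantum algorithms

   The machine model is a classical computer driving a quantum register.  The
   classical part is a while-language whose values are binary trees, handled
   through pointers: building a node, taking a child and testing for a leaf are
   unit-time operations, and a random-access memory is available, at the price
   of a logarithmic factor, as a balanced tree.  The program can allocate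
   qubits in state |0>, apply gates to them and measure them, and its control
   flow may depend on the outcomes of the measurements. *)

Inductive tree : Type := Leaf | Node (l r : tree).

Definition tree_eq_dec (u v : tree) : {u = v} + {u <> v}.
Proof. decide equality. Defined.

(* A natural number is a list of that length.  As a name of a qubit it behaves
   like a pointer: it can be stored, copied, and moved to a neighbour in unit
   time. *)
Fixpoint nat_of_tree (u : tree) : nat :=
  match u with Leaf => O | Node _ r => S (nat_of_tree r) end.

Definition tree_of_bool (b : bool) : tree := if b then Node Leaf Leaf else Leaf.

Definition tree_of_list {A : Type} (enc : A -> tree) (s : list A) : tree :=
  fold_right (fun a u => Node (enc a) u) Leaf s.

Definition tree_of_nat (k : nat) : tree :=
  tree_of_list (fun _ : unit => Leaf) (repeat tt k).

Inductive expr : Type :=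
| Var (x : nat)
| Nil
| Cons (e1 e2 : expr)
| Hd (e : expr)
| Tl (e : expr).

Inductive com : Type :=
| Assign (x : nat) (e : expr)
| Seq (c1 c2 : com)
| If (e : expr) (c1 c2 : com)
| While (e : expr) (c : com)
| NewQubit
| Apply (g : gate nat)     (* the qubits are named by the values of variables *)
| Measure (q x : nat).     (* the qubit named by variable q; outcome in x *)

Definition store : Type := nat -> tree.

Definition upd (s : store) (x : nat) (u : tree) : store :=
  fun y => if Nat.eq_dec y x then u else s y.

Fixpoint eval (s : store) (e : expr) : tree :=
  match e with
  | Var x => s x
  | Nil => Leaf
  | Cons e1 e2 => Node (eval s e1) (eval s e2)
  | Hd e => match eval s e with Leaf => Leaf | Node l _ => l end
  | Tl e => match eval s e with Leaf => Leaf | Node _ r => r end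
  end.

Definition is_leaf (u : tree) : bool :=
  match u with Leaf => true | Node _ _ => false end.

(* Commands still to be executed, classical memory, number of allocated qubits
   and their state.  The state is not renormalised after a measurement: its
   squared norm is the probability of the outcomes observed so far. *)
Record config : Type := Config {
  todo : list com;
  mem : store;
  nqubits : nat;
  qstate : state
}.

Definition gate_ok_dec (k : nat) (g : gate nat) : {gate_ok k g} + {~ gate_ok k g}.
Proof.
  unfold gate_ok.
  destruct (NoDup_dec Nat.eq_dec (gate_qubits g)) as [H1 | H1];
    [ | right; tauto ].
  destruct (Forall_dec (fun i => (i < k)%nat) (fun i => lt_dec i k) (gate_qubits g))
    as [H2 | H2]; [ left; tauto | right; tauto ].
Defined.

(* The new qubit has index k. *)
Definition add_qubit (k : nat) (psi : state) : state :=
  fun b => if bit k b then RtoC 0 else psi (firstn k b).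

Definition project (i : nat) (v : bool) (psi : state) : state :=
  fun b => if Bool.eqb (bit i b) v then psi b else RtoC 0.

(* The successors of a configuration whose first command is c: two for a
   measurement, one otherwise.  Gates on unallocated or repeated qubits are
   skipped, and measuring an unallocated qubit yields 0. *)
Definition step (c : com) (K : list com) (s : store) (k : nat) (psi : state)
  : list config :=
  match c with
  | Assign x e => [Config K (upd s x (eval s e)) k psi]
  | Seq c1 c2 => [Config (c1 :: c2 :: K) s k psi]
  | If e c1 c2 => [Config ((if is_leaf (eval s e) then c2 else c1) :: K) s k psi]
  | While e c1 =>
      [Config (if is_leaf (eval s e) then K else c1 :: While e c1 :: K) s k psi]
  | NewQubit => [Config K s (S k) (add_qubit k psi)]
  | Apply g =>
      let g' := gate_map (fun x => nat_of_tree (s x)) g in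
      [Config K s k (if gate_ok_dec k g' then apply_gate g' psi else psi)]
  | Measure q x =>
      map (fun v => Config K (upd s x (tree_of_bool v)) k
                           (project (nat_of_tree (s q)) v psi))
          [false; true]
  end.

(* Probability that the computation halts within t steps, with an output (the
   final value of variable 0) satisfying P. *)
Fixpoint prob (P : tree -> bool) (t : nat) (cf : config) : R :=
  match todo cf, t with
  | [], _ => if P (mem cf O) then norm2 (nqubits cf) (qstate cf) else 0
  | _ :: _, O => 0
  | c :: K, S t' =>
      fold_right Rplus 0
        (map (prob P t') (step c K (mem cf) (nqubits cf) (qstate cf)))
  end.

(* The input is in variable 0; there are no qubits yet. *)
Definition start (A : com) (w : tree) : config :=
  Config [A] (upd (fun _ => Leaf) O w) O (ket []).

Definition halts_within (A : com) (w : tree) (t : nat) : Prop :=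
  prob (fun _ => true) t (start A w) = 1.

Definition outputs_whp (A : com) (w y : tree) : Prop :=
  exists t : nat, halts_within A w t /\
    2 / 3 <= prob (fun u => if tree_eq_dec u y then true else false) t (start A w).

(* Computational problems; psize is the parameter n in which running times are
   measured. *)
Record problem : Type := Problem {
  instance : Type;
  psize : instance -> nat;
  encode : instance -> tree;
  answer : instance -> tree
}.

(* A is a bounded-error algorithm for the instances of p that satisfy D. *)
Definition solves (A : com) (p : problem) (D : instance p -> Prop) : Prop :=
  forall i : instance p, D i -> outputs_whp A (encode p i) (answer p i).

(* On the instances satisfying D, the running time of A is O(f(n)). *)
Definition time_O (A : com) (p : problem) (D : instance p -> Prop) (f : nat -> R)
  : Prop :=
  exists (B : R) (n0 : nat), forall i : instance p,
    D i -> (n0 <= psize p i)%nat ->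
    exists t : nat, INR t <= B * f (psize p i) /\ halts_within A (encode p i) t.

(* 2^(n(1-delta)) *)
Definition exp_time (delta : R) (n : nat) : R := Rpower 2 (INR n * (1 - delta)).

(** * maj-CNFSAT *)

(* (true, v) is the variable v and (false, v) is its negation. *)
Definition literal : Type := (bool * nat)%type.
Definition clause : Type := list literal.
Definition cnf : Type := list clause.

(* Clauses are sets of literals: with repetitions allowed, the size of a formula
   would not be bounded in terms of its numbers of variables and clauses. *)
Definition clause_ok (n : nat) (cl : clause) : Prop :=
  NoDup cl /\ Forall (fun l : literal => (snd l < n)%nat) cl.

Definition cnf_ok (n : nat) (phi : cnf) : Prop := Forall (clause_ok n) phi.

Definition sat_literal (a : list bool) (l : literal) : bool :=
  Bool.eqb (bit (snd l) a) (fst l).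

Definition sat (a : list bool) (phi : cnf) : bool :=
  forallb (existsb (sat_literal a)) phi.

Definition count_sat (n : nat) (phi : cnf) : nat :=
  length (filter (fun a => sat a phi) (bitstrings n)).

Definition maj (n : nat) (phi : cnf) : bool := (2 ^ n <=? 2 * count_sat n phi)%nat.

Record cnf_instance : Type := CnfInstance {
  cnf_vars : nat;
  cnf_formula : cnf;
  cnf_wf : cnf_ok cnf_vars cnf_formula
}.

Definition tree_of_literal (l : literal) : tree :=
  Node (tree_of_bool (fst l)) (tree_of_nat (snd l)).

Definition maj_cnfsat : problem := {|
  instance := cnf_instance;
  psize := cnf_vars;
  encode := fun i =>
    Node (tree_of_nat (cnf_vars i))
         (tree_of_list (tree_of_list tree_of_literal) (cnf_formula i));
  answer := fun i => tree_of_bool (maj (cnf_vars i) (cnf_formula i))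
|}.

Definition few_clauses (c : R) (i : instance maj_cnfsat) : Prop :=
  INR (length (cnf_formula i)) <= c * INR (cnf_vars i) ^ 2.

Definition majority_QSETH : Prop :=
  forall delta : R, 0 < delta ->
  exists c : R, 0 < c /\
    ~ exists A : com,
        solves A maj_cnfsat (few_clauses c) /\
        time_O A maj_cnfsat (few_clauses c) (exp_time delta).

(** * Strong simulation *)

(* The digit C_k of the binary expansion C_0.C_1C_2... of r in [0, 1]. *)
Definition binary_digit (r : R) (k : nat) : bool := Z.odd (Int_part (2 ^ k * r)).

Record sim_instance : Type := SimInstance {
  sim_qubits : nat;
  sim_circuit : circuit;
  sim_x : list bool;
  sim_circuit_ok : circuit_ok sim_qubits sim_circuit;
  sim_x_ok : length sim_x = sim_qubits
}.

Definition tree_of_gate (g : gate nat) : tree :=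
  let tag := match g with
             | GH _ => 0 | GT _ => 1 | GX _ => 2 | GCX _ _ => 3 | GCCX _ _ _ => 4
             end%nat in
  Node (tree_of_nat tag) (tree_of_list tree_of_nat (gate_qubits g)).

Definition strong_simulation (p : nat) : problem := {|
  instance := sim_instance;
  psize := sim_qubits;
  encode := fun i =>
    Node (tree_of_nat (sim_qubits i))
         (Node (tree_of_list tree_of_gate (sim_circuit i))
               (tree_of_list tree_of_bool (sim_x i)));
  answer := fun i =>
    tree_of_list tree_of_bool
      (map (binary_digit (Cmod (amplitude (sim_qubits i) (sim_circuit i) (sim_x i))))
           (seq 0 p))
|}.

Definition few_gates (p d : nat) (i : instance (strong_simulation p)) : Prop :=
  (length (sim_circuit i) <= sim_qubits i ^ d)%nat.

(* A must be correct on all circuits.  A running time depending only on the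
   number n of qubits is meaningful only if the size of the circuits is bounded
   in terms of n: it is required, with a constant depending on d, on circuits
   with at most n^d gates, for every d. *)
Definition solves_strong_simulation (A : com) (p : nat) (f : nat -> R) : Prop :=
  solves A (strong_simulation p) (fun _ => True) /\
  forall d : nat, time_O A (strong_simulation p) (few_gates p d) f.

(* Main.v *)
(** A formula [phi] with [n] variables is turned into a circuit [H^n Q H^n], where
   the reversible part [Q] leads the ancillas back to zero exactly on the
   satisfying assignments; hence the amplitude at zero is the fraction of
   satisfying assignments, and its first two binary digits decide majority.

   To use only [n + O(log n)] qubits, [Q] counts with two
   [k]-digit registers, [2^k > 2n, m].  Starting from -1, the low one counts the
   true literals of a clause; it overflows into the high one at the next
   increment iff the clause is false, and is then counted back to zero.  The
   high register, which ends with the number of false clauses, need not be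
   uncomputed: the amplitude selects its value zero.

   The circuit is written down in polynomial time, and [2^(4k+1)] is polynomial
   in [n], so all overheads are absorbed by replacing [delta] by [min(delta, 1) / 2]. *)

Require Import Defs.
From Stdlib Require Import Reals List ZArith Arith Bool Lia Lra FunctionalExtensionality.
From Coquelicot Require Import Complex.
Import ListNotations.
Open Scope R_scope.

(** * Timed execution of commands that leave the quantum register alone *)

Definition exec (c : com) (s s' : store) (T : nat) : Prop :=
  forall P t K k psi,
    prob P (T + t) (Config (c :: K) s k psi) = prob P t (Config K s' k psi).

(** [exec] is an equation with an exact step count, valid under every continuation, so it composes
    by rewriting; only an upper bound on that count is worth tracking. *)
Definition runs (c : com) (s s' : store) (B : nat) : Prop :=
  exists T, (T <= B)%nat /\ exec c s s' T.

Lemma runs_weaken c s s' B B' : (B <= B')%nat -> runs c s s' B -> runs c s s' B'.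
Proof. intros H (T & HT & He). exists T. split; [lia | exact He]. Qed.

Lemma runs_assign x e s : runs (Assign x e) s (upd s x (eval s e)) 1.
Proof.
  exists 1%nat. split; [lia|]. intros P t K k psi. simpl. apply Rplus_0_r.
Qed.

Lemma runs_seq c d s1 s2 s3 B1 B2 :
  runs c s1 s2 B1 -> runs d s2 s3 B2 -> runs (Seq c d) s1 s3 (B1 + B2 + 1).
Proof.
  intros (T1 & H1 & E1) (T2 & H2 & E2). exists (S (T1 + T2)). split; [lia|].
  intros P t K k psi. simpl. rewrite Rplus_0_r, <- Nat.add_assoc, E1. apply E2.
Qed.

Lemma runs_if e c d s s' B :
  runs (if is_leaf (eval s e) then d else c) s s' B -> runs (If e c d) s s' (B + 1).
Proof.
  intros (T & H & E). exists (S T). split; [lia|].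
  intros P t K k psi. simpl. rewrite Rplus_0_r. apply E.
Qed.

Lemma runs_while_leaf e c s : is_leaf (eval s e) = true -> runs (While e c) s s 1.
Proof.
  intros H. exists 1%nat. split; [lia|].
  intros P t K k psi. simpl. rewrite H. apply Rplus_0_r.
Qed.

Lemma runs_while_node e c s1 s2 s3 B1 B2 :
  is_leaf (eval s1 e) = false -> runs c s1 s2 B1 -> runs (While e c) s2 s3 B2 ->
  runs (While e c) s1 s3 (B1 + B2 + 1).
Proof.
  intros H (T1 & H1 & E1) (T2 & H2 & E2). exists (S (T1 + T2)). split; [lia|].
  intros P t K k psi. simpl. rewrite H, Rplus_0_r, <- Nat.add_assoc, E1. apply E2.
Qed.

(** * Memory as a finite list, for symbolic execution *)

Definition mk (l : list tree) : store := fun x => nth x l Leaf.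

Fixpoint put (x : nat) (u : tree) (l : list tree) : list tree :=
  match x, l with
  | O, [] => [u]
  | O, _ :: l' => u :: l'
  | S x', [] => Leaf :: put x' u []
  | S x', v :: l' => v :: put x' u l'
  end.

Lemma nth_put x u l y :
  nth y (put x u l) Leaf = if Nat.eq_dec y x then u else nth y l Leaf.
Proof.
  revert l y. induction x as [|x IH]; intros [|v l] [|y]; simpl; try reflexivity.
  - destruct y; reflexivity.
  - rewrite IH. destruct (Nat.eq_dec y x), (Nat.eq_dec (S y) (S x)); try lia;
      destruct y; reflexivity.
  - rewrite IH. destruct (Nat.eq_dec y x), (Nat.eq_dec (S y) (S x)); lia || reflexivity.
Qed.

Lemma upd_mk l x u : upd (mk l) x u = mk (put x u l).
Proof.
  apply functional_extensionality. intros y. unfold upd, mk. now rewrite nth_put.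
Qed.

Lemma runs_assign_mk x e l :
  runs (Assign x e) (mk l) (mk (put x (eval (mk l) e) l)) 1.
Proof. rewrite <- upd_mk. apply runs_assign. Qed.

(** A loop that consumes the list in variable [x] is a fold: [emb u s] lays out the memory with the
    unread part [u] in [x] and the loop state [s] elsewhere. The body itself removes the head of the
    list. *)
Lemma runs_for {X S : Type} (enc : X -> tree) (x : nat) (body : com)
    (emb : tree -> S -> list tree) (g : S -> X -> S) (B : nat) (xs : list X) (s : S) :
  (forall u s, nth x (emb u s) Leaf = u) ->
  (forall a u s, In a xs ->
     runs body (mk (emb (Node (enc a) u) s)) (mk (emb u (g s a))) B) ->
  runs (While (Var x) body) (mk (emb (tree_of_list enc xs) s))
    (mk (emb Leaf (fold_left g xs s))) (length xs * (B + 1) + 1).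
Proof.
  intros Hx. revert s. induction xs as [|a xs IH]; intros s Hb.
  - apply runs_while_leaf. simpl. unfold mk. now rewrite Hx.
  - eapply runs_weaken; [|eapply runs_while_node; [| apply Hb; now left
                          | apply IH; intros; apply Hb; now right]].
    + simpl. lia.
    + simpl. unfold mk. now rewrite Hx.
Qed.

(** * Postprocessing the output of a quantum program *)

Lemma prob_todo_long P t L s k psi :
  (t < length L)%nat -> prob P t (Config L s k psi) = 0.
Proof.
  revert L s k psi. induction t as [|t IH]; intros [|c L] s k psi H; simpl in H; try lia.
  - reflexivity.
  - destruct c; simpl; try destruct (is_leaf (eval s e));
      rewrite ?IH by (simpl; lia); lra.
Qed.

(* The answer [C_0; C_1] has exactly one true digit if it encodes a number >= 1/2. *)
Definition post : com :=
  If (Hd (Var 0)) (Assign 0 (Cons Nil Nil)) (Assign 0 (Hd (Tl (Var 0)))).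

Definition post_out (u : tree) : tree :=
  if is_leaf (eval (mk [u]) (Hd (Var 0))) then eval (mk [u]) (Hd (Tl (Var 0)))
  else Node Leaf Leaf.

Lemma prob_post_halted P t s k psi :
  prob P (S (S t)) (Config [post] s k psi) =
  if P (post_out (s O)) then norm2 k psi else 0.
Proof.
  unfold post, post_out, mk. simpl. rewrite Rplus_0_r.
  destruct (is_leaf _); simpl; destruct t; simpl; unfold upd; simpl; apply Rplus_0_r.
Qed.

Lemma prob_post P t L s k psi :
  prob P (S (S t)) (Config (L ++ [post]) s k psi)
  = prob (fun u => P (post_out u)) t (Config L s k psi).
Proof.
  revert L s k psi. induction t as [|t IH]; intros [|c L] s k psi.
  - apply prob_post_halted.
  (* No fuel is left for [L] on the right. On the left one unit remains after the first step, too
     little for a list that still ends with the two-step [post]. *)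
  - assert (H1 : forall L' s' k' psi',
      prob P 1 (Config (L' ++ [post]) s' k' psi') = 0).
    { intros [|c' L'] s' k' psi'.
      - unfold post. simpl. lra.
      - apply prob_todo_long. simpl. rewrite length_app. simpl. lia. }
    assert (H2 : forall c' L' s' k' psi',
      prob P 1 (Config (c' :: L' ++ [post]) s' k' psi') = 0)
     by (intros; apply (H1 (_ :: _))).
    assert (H3 : forall c' c'' L' s' k' psi',
      prob P 1 (Config (c' :: c'' :: L' ++ [post]) s' k' psi') = 0)
     by (intros; apply (H1 (_ :: _ :: _))).
    remember 1%nat as one eqn:E.
    destruct c; simpl; rewrite ?H1, ?H2, ?H3; try lra.
    destruct (is_leaf (eval s e)); rewrite ?H1, ?H3; lra.
  - apply (prob_post_halted P (S t)).
  - remember (S (S t)) as t2 eqn:E2. remember (S t) as t1. simpl.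
    subst t1. remember (S t) as t1.
    (* [step] commutes with appending [post] to the pending commands, so the successors can be
       compared one by one. *)
    cut (forall cs, fold_right Rplus 0 (map (prob P t2)
       (map (fun cf => Config (todo cf ++ [post]) (mem cf) (nqubits cf) (qstate cf)) cs)) =
       fold_right Rplus 0 (map (prob (fun u => P (post_out u)) t) cs)).
    { intros H. transitivity (fold_right Rplus 0
       (map (prob (fun u => P (post_out u)) t) (step c L s k psi))).
      - rewrite <- H. rewrite E2. destruct c; simpl; try reflexivity.
        destruct (is_leaf (eval s e)); reflexivity.
      - subst t1. reflexivity. }
    intros cs. induction cs as [|[L' s' k' psi'] cs IHc]; [reflexivity|].
    simpl map. simpl fold_right. rewrite IHc. f_equal. subst t2. apply IH.
Qed.

(** * Reversible circuits acting on basis states *)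

Definition classical (g : gate nat) : Prop :=
  match g with GH _ | GT _ => False | _ => True end.

Definition cact (g : gate nat) (b : list bool) : list bool :=
  match g with
  | GH _ | GT _ => b
  | GX i => flip_bit i b
  | GCX i j => if bit i b then flip_bit j b else b
  | GCCX i j l => if bit i b && bit j b then flip_bit l b else b
  end.

(* Basis states are pulled back: the head of the list, which is the first gate
   of the circuit, acts last. *)
Definition run (c : circuit) (b : list bool) : list bool := fold_right cact b c.

Lemma run_cons g c b : run (g :: c) b = cact g (run c b).
Proof. reflexivity. Qed.

Lemma run_nil b : run [] b = b.
Proof. reflexivity. Qed.

Lemma run_app c1 c2 b : run (c1 ++ c2) b = run c1 (run c2 b).
Proof. apply fold_right_app. Qed.

Lemma apply_classical c psi b :
  Forall classical c -> apply_circuit c psi b = psi (run c b).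
Proof.
  intros H. revert psi. induction H as [|g c Hg Hc IH]; intros psi; [reflexivity|].
  change (apply_circuit (g :: c) psi b) with (apply_circuit c (apply_gate g psi) b).
  rewrite IH. destruct g; simpl in *; tauto || reflexivity.
Qed.

Lemma apply_circuit_app c1 c2 psi :
  apply_circuit (c1 ++ c2) psi = apply_circuit c2 (apply_circuit c1 psi).
Proof. apply fold_left_app. Qed.

Lemma set_bit_app a l j v : set_bit (length a + j) v (a ++ l) = a ++ set_bit j v l.
Proof. induction a; simpl; congruence. Qed.

Lemma bit_app a l j : bit (length a + j) (a ++ l) = bit j l.
Proof. unfold bit. rewrite app_nth2 by lia. f_equal. lia. Qed.

Lemma flip_bit_app a l j : flip_bit (length a + j) (a ++ l) = a ++ flip_bit j l.
Proof. unfold flip_bit. now rewrite bit_app, set_bit_app. Qed.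

(** * Counters *)

(* The wires of a counter from position q on: the carries are interleaved with
   the binary digits, least significant first. *)
Definition wires (u : bool) (rs : list bool) : list bool :=
  u :: flat_map (fun r => [r; false]) rs.

Definition ccx (q : nat) : gate nat := GCCX q (S q) (S (S q)).
Definition cx (q : nat) : gate nat := GCX q (S q).

(** A ripple-carry adder of the bit on wire [q]. Read from right to left, as [run] does: compute the
    next carry, increment the higher digits, uncompute the carry while the digit is still unchanged,
    then flip the digit. *)
Fixpoint incr_circ (q k : nat) : circuit :=
  match k with
  | O => []
  | S k' => cx q :: ccx q :: incr_circ (S (S q)) k' ++ [ccx q]
  end.

Fixpoint incr (u : bool) (rs : list bool) : list bool :=
  match rs with [] => [] | r :: rs' => xorb r u :: incr (u && r) rs' end.

Fixpoint decr (u : bool) (rs : list bool) : list bool :=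
  match rs with [] => [] | r :: rs' => xorb r u :: decr (u && negb r) rs' end.

Arguments wires : simpl never.
Arguments ccx : simpl never.
Arguments cx : simpl never.
Arguments run : simpl never.

Lemma wires_cons u r rs : wires u (r :: rs) = u :: r :: wires false rs.
Proof. reflexivity. Qed.

Lemma cact_ccx a u r v rs :
  cact (ccx (length a)) (a ++ u :: r :: wires v rs)
  = a ++ u :: r :: wires (xorb v (u && r)) rs.
Proof.
  unfold ccx, cact, wires.
  pose proof (bit_app a (u :: r :: v :: flat_map (fun r => [r; false]) rs)) as H.
  pose proof (H 0%nat) as H0. pose proof (H 1%nat) as H1.
  pose proof (flip_bit_app a (u :: r :: v :: flat_map (fun r => [r; false]) rs) 2) as H2.
  rewrite Nat.add_comm in H1, H2. rewrite Nat.add_0_r in H0. simpl in H1, H2.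
  rewrite H0, H1, H2. unfold bit, flip_bit, bit. simpl.
  destruct u, r, v; reflexivity.
Qed.

Lemma cact_cx a u r l :
  cact (cx (length a)) (a ++ u :: r :: l) = a ++ u :: xorb r u :: l.
Proof.
  unfold cx, cact.
  pose proof (bit_app a (u :: r :: l) 0) as H0.
  pose proof (flip_bit_app a (u :: r :: l) 1) as H1.
  rewrite Nat.add_comm in H1. rewrite Nat.add_0_r in H0. simpl in H1.
  rewrite H0, H1. unfold bit, flip_bit, bit. simpl.
  destruct u, r; reflexivity.
Qed.

(** The digits [ts] above the counter stay fixed, so the low half of a longer register can be
    incremented on its own. *)
Lemma run_incr a u rs ts :
  run (incr_circ (length a) (length rs)) (a ++ wires u (rs ++ ts))
  = a ++ wires u (incr u rs ++ ts).
Proof.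
  revert a u. induction rs as [|r rs IH]; intros a u; [reflexivity|].
  simpl app. simpl length. rewrite wires_cons. simpl incr_circ.
  rewrite !run_cons, run_app, run_cons, run_nil, cact_ccx.
  (* The first two wires join the prefix, so that the remaining counter starts at its own carry
     wire. *)
  specialize (IH (a ++ [u; r]) (xorb false (u && r))).
  rewrite length_app in IH. simpl length in IH. rewrite Nat.add_comm in IH. simpl in IH.
  rewrite <- !app_assoc in IH. simpl in IH. simpl xorb. rewrite IH.
  rewrite cact_ccx, cact_cx, xorb_nilpotent. reflexivity.
Qed.

Lemma run_decr a u rs ts :
  run (rev (incr_circ (length a) (length rs))) (a ++ wires u (rs ++ ts))
  = a ++ wires u (decr u rs ++ ts).
Proof.
  revert a u. induction rs as [|r rs IH]; intros a u; [reflexivity|].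
  simpl app. simpl length. rewrite wires_cons. simpl incr_circ. simpl rev.
  rewrite rev_app_distr, <- app_assoc. simpl rev. simpl app.
  rewrite !run_cons, run_app, !run_cons, run_nil, cact_cx, cact_ccx.
  specialize (IH (a ++ [u; xorb r u]) (u && negb r)).
  rewrite length_app in IH. simpl length in IH. rewrite Nat.add_comm in IH. simpl in IH.
  rewrite <- !app_assoc in IH. simpl in IH.
  (* In the reversed circuit the digit is flipped first, so the computed carry is the borrow of a
     subtraction. *)
  replace (xorb false (u && xorb r u)) with (u && negb r) by (destruct u, r; reflexivity).
  rewrite IH, cact_ccx.
  replace (xorb (u && negb r) (u && xorb r u)) with false by (destruct u, r; reflexivity).
  reflexivity.
Qed.

Fixpoint val (rs : list bool) : nat :=
  match rs with [] => 0 | r :: rs' => Nat.b2n r + 2 * val rs' end%nat.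

Definition all1 (rs : list bool) : bool := forallb (fun r => r) rs.

(** The term with [2 ^ length rs] is the carry lost at the top. *)
Lemma val_incr u rs :
  (val (incr u rs) + 2 ^ length rs * Nat.b2n (u && all1 rs) = val rs + Nat.b2n u)%nat.
Proof.
  revert u. induction rs as [|r rs IH]; intros u; simpl.
  - destruct u; reflexivity.
  - specialize (IH (u && r)). fold (all1 rs).
    replace (u && (r && all1 rs)) with (u && r && all1 rs)
      by (destruct u, r; reflexivity).
    destruct u, r, (all1 rs); simpl in *; lia.
Qed.

Lemma incr_length u rs : length (incr u rs) = length rs.
Proof. revert u. induction rs; intros; simpl; congruence. Qed.

Lemma decr_length u rs : length (decr u rs) = length rs.
Proof. revert u. induction rs; intros; simpl; congruence. Qed.

Lemma decr_incr u rs : decr u (incr u rs) = rs.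
Proof.
  revert u. induction rs as [|r rs IH]; intros u; simpl; [reflexivity|].
  replace (u && negb (xorb r u)) with (u && r) by (destruct u, r; reflexivity).
  rewrite IH. destruct u, r; reflexivity.
Qed.

Lemma incr_decr u rs : incr u (decr u rs) = rs.
Proof.
  revert u. induction rs as [|r rs IH]; intros u; simpl; [reflexivity|].
  replace (u && xorb r u) with (u && negb r) by (destruct u, r; reflexivity).
  rewrite IH. destruct u, r; reflexivity.
Qed.

Lemma incr_false rs : incr false rs = rs.
Proof. induction rs as [|r rs IH]; simpl; [|rewrite IH]; now rewrite ?xorb_false_r. Qed.

Lemma decr_false rs : decr false rs = rs.
Proof. induction rs as [|r rs IH]; simpl; [|rewrite IH]; now rewrite ?xorb_false_r. Qed.

Lemma incr_app u rs ts : incr u (rs ++ ts) = incr u rs ++ incr (u && all1 rs) ts.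
Proof.
  revert u. induction rs as [|r rs IH]; intros u; simpl.
  - now rewrite andb_true_r.
  - rewrite IH. now rewrite andb_assoc.
Qed.

Definition zeros (k : nat) : list bool := repeat false k.

Lemma zeros_length k : length (zeros k) = k.
Proof. apply repeat_length. Qed.

Lemma val_zeros k : val (zeros k) = 0%nat.
Proof. unfold zeros. induction k as [|k IH]; simpl; [|rewrite IH]; reflexivity. Qed.

Lemma val_iter_incr k j :
  (j < 2 ^ k)%nat -> val (Nat.iter j (incr true) (zeros k)) = j.
Proof.
  assert (L : forall j, length (Nat.iter j (incr true) (zeros k)) = k).
  { intros i. induction i; simpl; [apply repeat_length|]. now rewrite incr_length. }
  induction j as [|j IH]; intros H; [apply val_zeros|].
  change (val (incr true (Nat.iter j (incr true) (zeros k))) = S j).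
  pose proof (val_incr true (Nat.iter j (incr true) (zeros k))) as V.
  rewrite L, IH in V by lia. rewrite andb_true_l in V. destruct (all1 _); simpl Nat.b2n in V; lia.
Qed.

Lemma iter_incr_zeros k j :
  (j < 2 ^ k)%nat -> Nat.iter j (incr true) (zeros k) = zeros k -> j = 0%nat.
Proof. intros H E. rewrite <- (val_iter_incr k j H), E. apply val_zeros. Qed.

Lemma iter_comm {A} (f : A -> A) n x : Nat.iter n f (f x) = f (Nat.iter n f x).
Proof. induction n; simpl; congruence. Qed.

Lemma iter_decr_incr j rs :
  Nat.iter j (decr true) (Nat.iter j (incr true) rs) = rs.
Proof.
  revert rs. induction j as [|j IH]; intros rs; [reflexivity|].
  simpl. rewrite <- iter_comm, decr_incr. apply IH.
Qed.

Lemma all1_incr rs : all1 rs = true -> incr true rs = zeros (length rs).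
Proof.
  induction rs as [|r rs IH]; simpl; [reflexivity|]. fold (all1 rs).
  destruct r; simpl; [|discriminate]. intros H. now rewrite IH.
Qed.

(** The start value is all ones, that is -1. One further increment gives [j] increments of zero,
    which do not wrap around below [2 ^ k]; the carry term of [val_incr] then separates [j = 0] from
    [j > 0]. *)
Lemma all1_iter k j :
  (j < 2 ^ k)%nat ->
  all1 (Nat.iter j (incr true) (decr true (zeros k))) = Nat.eqb j 0.
Proof.
  intros H. set (w := Nat.iter j _ _).
  assert (E : incr true w = Nat.iter j (incr true) (zeros k)).
  { unfold w. rewrite <- iter_comm, incr_decr. reflexivity. }
  assert (L : length w = k).
  { unfold w. clear. induction j; simpl.
    - rewrite decr_length. apply repeat_length.
    - now rewrite incr_length. }
  pose proof (val_incr true w) as V. rewrite E, L, val_iter_incr in V by exact H.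
  destruct (all1 w) eqn:A; symmetry.
  - apply Nat.eqb_eq. apply (iter_incr_zeros k); [exact H|].
    rewrite <- E, all1_incr by exact A. now rewrite L.
  - apply Nat.eqb_neq. simpl in V. lia.
Qed.

(** * Evaluating a formula *)

(** [p] computes a control bit on the carry wire and, being an exclusive or, also erases it. The
    pieces are reversed because the program builds circuits by prepending one gate at a time. *)
Definition add_ctrl (p J : circuit) : circuit := rev p ++ rev J ++ rev p.

Definition lit_circ (n : nat) (l : literal) : circuit :=
  GCX (snd l) n :: (if fst l then [] else [GX n]).

(** [run] reads the lines from the bottom up, and [add_ctrl] reverses its second argument: set the
    low counter to -1, count up the true literals, increment the whole register, count the true
    literals down again. *)
Definition clause_circ (n k : nat) (cl : clause) : circuit :=
  flat_map (fun l => add_ctrl (lit_circ n l) (incr_circ n k)) (rev cl)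
  ++ add_ctrl [GX n] (rev (incr_circ n (2 * k)))
  ++ flat_map (fun l => add_ctrl (lit_circ n l) (rev (incr_circ n k))) (rev cl)
  ++ add_ctrl [GX n] (incr_circ n k).

Definition formula_circ (n k : nat) (phi : cnf) : circuit :=
  flat_map (clause_circ n k) (rev phi).

Lemma run_flat_map {A} (f : A -> circuit) xs b :
  run (flat_map f (rev xs)) b = fold_left (fun b x => run (f x) b) xs b.
Proof.
  revert b. induction xs as [|x xs IH]; intros b; [reflexivity|].
  simpl. rewrite flat_map_app, run_app. simpl. rewrite app_nil_r. apply IH.
Qed.

Lemma cact_GX a u l : cact (GX (length a)) (a ++ u :: l) = a ++ negb u :: l.
Proof.
  simpl. pose proof (flip_bit_app a (u :: l) 0) as H. rewrite Nat.add_0_r in H.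
  exact H.
Qed.

Lemma cact_GCX_var a v u l :
  (v < length a)%nat ->
  cact (GCX v (length a)) (a ++ u :: l) = a ++ xorb u (bit v a) :: l.
Proof.
  intros H. simpl. unfold bit at 1. rewrite app_nth1 by exact H. fold (bit v a).
  pose proof (flip_bit_app a (u :: l) 0) as F. rewrite Nat.add_0_r in F. rewrite F.
  destruct (bit v a), u; reflexivity.
Qed.

Lemma run_lit a u l rs :
  (snd l < length a)%nat ->
  run (rev (lit_circ (length a) l)) (a ++ wires u rs)
  = a ++ wires (xorb u (sat_literal a l)) rs.
Proof.
  intros H. unfold lit_circ, sat_literal, wires. destruct l as [[|] v];
    cbn [fst snd rev app] in *; rewrite !run_cons, run_nil, cact_GCX_var by exact H.
  - destruct (bit v a), u; reflexivity.
  - rewrite cact_GX. destruct (bit v a), u; reflexivity.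
Qed.

(** Since [J] preserves the carry wire, the second copy of [p] adds [s] to it again and clears
    it. *)
Lemma run_add_ctrl a p J s f rs :
  (forall u rs, run (rev p) (a ++ wires u rs) = a ++ wires (xorb u s) rs) ->
  (forall u, run (rev J) (a ++ wires u rs) = a ++ wires u (f u rs)) ->
  run (add_ctrl p J) (a ++ wires false rs) = a ++ wires false (f s rs).
Proof.
  intros Hp HJ. unfold add_ctrl. rewrite !run_app, Hp, HJ, Hp.
  now destruct s.
Qed.

Lemma run_GX a u rs : run (rev [GX (length a)]) (a ++ wires u rs) = a ++ wires (xorb u true) rs.
Proof.
  unfold wires. simpl rev. rewrite run_cons, run_nil, cact_GX. now destruct u.
Qed.

Definition count_true (a : list bool) (cl : clause) : nat :=
  length (filter (sat_literal a) cl).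

Lemma run_pass a J f cl low high :
  Forall (fun l : literal => (snd l < length a)%nat) cl ->
  (forall rs, f false rs = rs) ->
  (forall u rs, length (f u rs) = length rs) ->
  (forall u rs, length rs = length low ->
     run (rev J) (a ++ wires u (rs ++ high)) = a ++ wires u (f u rs ++ high)) ->
  run (flat_map (fun l => add_ctrl (lit_circ (length a) l) J) (rev cl))
    (a ++ wires false (low ++ high))
  = a ++ wires false (Nat.iter (count_true a cl) (f true) low ++ high).
Proof.
  intros Hcl Hf Hl HJ. rewrite run_flat_map. revert low HJ.
  induction Hcl as [|l cl Hv Hcl IH]; intros low HJ; [reflexivity|].
  (* The function has to be defined on the whole register, so [firstn] cuts out the low counter, the
     only part that [J] changes. *)
  simpl. rewrite (run_add_ctrl a _ _ (sat_literal a l)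
    (fun u rs => f u (firstn (length low) rs) ++ high)).
  - rewrite firstn_app, Nat.sub_diag, firstn_all. simpl. rewrite app_nil_r.
    rewrite IH.
    + unfold count_true. simpl. destruct (sat_literal a l); simpl.
      * now rewrite iter_comm.
      * now rewrite Hf.
    + intros u rs E. rewrite Hl in E. now apply HJ.
  - intros u rs. now apply run_lit.
  - intros u. rewrite firstn_app, Nat.sub_diag, firstn_all. simpl. rewrite app_nil_r.
    now apply HJ.
Qed.

Lemma sat_clause_count a cl :
  existsb (sat_literal a) cl = negb (Nat.eqb (count_true a cl) 0).
Proof.
  unfold count_true. induction cl as [|l cl IH]; simpl; [reflexivity|].
  destruct (sat_literal a l); simpl; [reflexivity|exact IH].
Qed.

Lemma iter_length f j rs : (forall rs, length (f rs) = length rs) ->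
  length (Nat.iter j f rs) = length (rs : list bool).
Proof. intros H. induction j; simpl; congruence. Qed.

(* The low counter holds -1 plus the number of true literals, so that adding 1
   to the whole register carries into the high counter iff the clause is false. *)
Lemma run_clause a k cl high :
  Forall (fun l : literal => (snd l < length a)%nat) cl ->
  (length cl < 2 ^ k)%nat -> length high = k ->
  run (clause_circ (length a) k cl) (a ++ wires false (zeros k ++ high))
  = a ++ wires false
        (zeros k ++ incr (negb (existsb (sat_literal a) cl)) high).
Proof.
  intros Hcl Hk Hh. unfold clause_circ. rewrite !run_app.
  assert (Hz : length (zeros k) = k) by apply repeat_length.
  assert (Hj : (count_true a cl < 2 ^ k)%nat).
  { unfold count_true. pose proof (filter_length_le (sat_literal a) cl). lia. }
  set (j := count_true a cl) in *.
  assert (Rd : forall u rs high, length rs = k ->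
    run (rev (incr_circ (length a) k)) (a ++ wires u (rs ++ high))
    = a ++ wires u (decr u rs ++ high)) by (intros u rs ts <-; apply run_decr).
  assert (Ri : forall u rs high, length rs = k ->
    run (rev (rev (incr_circ (length a) k))) (a ++ wires u (rs ++ high))
    = a ++ wires u (incr u rs ++ high))
    by (intros u rs ts <-; rewrite rev_involutive; apply run_incr).
  rewrite (run_add_ctrl a _ _ true (fun u _ => decr u (zeros k) ++ high));
    [| intros; apply run_GX | intros; now apply Rd].
  rewrite (run_pass a _ incr); [| exact Hcl | apply incr_false | apply incr_length
    | rewrite decr_length, Hz; intros; now apply Ri].
  fold j. set (w := Nat.iter j (incr true) (decr true (zeros k))).
  assert (Hw : length w = k).
  { unfold w. rewrite iter_length by (intros; apply incr_length).
    now rewrite decr_length. }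
  rewrite (run_add_ctrl a _ _ true (fun u rs => incr u rs));
    [| intros; apply run_GX |].
  2:{ intros u. rewrite rev_involutive.
      pose proof (run_incr a u (w ++ high) []) as R. rewrite !app_nil_r in R.
      rewrite length_app, Hw, Hh in R. replace (2 * k)%nat with (k + k)%nat by lia.
      exact R. }
  (* The carry into the high counter is [all1 w], which holds exactly when no literal is true. *)
  rewrite incr_app, andb_true_l. unfold w at 2. rewrite all1_iter by exact Hj.
  assert (E : incr true w = Nat.iter j (incr true) (zeros k)).
  { unfold w. rewrite <- iter_comm, incr_decr. reflexivity. }
  rewrite E, (run_pass a _ decr); [| exact Hcl | apply decr_false | apply decr_length |].
  2:{ intros u rs Hrs. rewrite iter_length in Hrs by (intros; apply incr_length).
      apply Rd. congruence. }
  fold j. rewrite iter_decr_incr. rewrite sat_clause_count. fold j.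
  now rewrite negb_involutive.
Qed.

Definition count_unsat (a : list bool) (phi : cnf) : nat :=
  length (filter (fun cl => negb (existsb (sat_literal a) cl)) phi).

Lemma run_formula a k phi :
  Forall (fun cl => Forall (fun l : literal => (snd l < length a)%nat) cl
                    /\ (length cl < 2 ^ k)%nat) phi ->
  run (formula_circ (length a) k phi) (a ++ wires false (zeros (2 * k)))
  = a ++ wires false (zeros k ++ Nat.iter (count_unsat a phi) (incr true) (zeros k)).
Proof.
  intros H. unfold formula_circ. rewrite run_flat_map.
  replace (zeros (2 * k)) with (zeros k ++ zeros k)
    by (unfold zeros; rewrite <- repeat_app; f_equal; lia).
  assert (L : length (zeros k) = k) by apply repeat_length.
  (* Only the high register is generalised: the low one is back at zero after each clause. *)
  revert L. generalize (zeros k) at 1 3 5 as high.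
  induction H as [|cl phi [Hcl Hk] Hphi IH]; intros high L; [reflexivity|].
  cbn [fold_left]. rewrite run_clause by assumption.
  rewrite IH by now rewrite incr_length. unfold count_unsat. cbn [filter].
  destruct (negb _); cbn [length Nat.iter nat_rect].
  - now rewrite iter_comm.
  - now rewrite incr_false.
Qed.

Lemma sat_count_unsat a phi : sat a phi = Nat.eqb (count_unsat a phi) 0.
Proof.
  unfold sat, count_unsat. induction phi as [|cl phi IH]; simpl; [reflexivity|].
  destruct (existsb _ cl); simpl; [exact IH|reflexivity].
Qed.

Lemma wires_zeros k : wires false (zeros (2 * k)) = zeros (4 * k + 1).
Proof.
  replace (4 * k + 1)%nat with (S (2 * (2 * k))) by lia.
  generalize (2 * k)%nat as m. intros m. unfold wires, zeros. simpl. f_equal.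
  induction m as [|m IH]; [reflexivity|].
  simpl. rewrite IH, <- plus_n_Sm. reflexivity.
Qed.

(** With fewer than [2 ^ k] clauses the count of false clauses cannot wrap around to zero. *)
Lemma run_formula_zeros a k phi :
  Forall (fun cl => Forall (fun l : literal => (snd l < length a)%nat) cl
                    /\ (length cl < 2 ^ k)%nat) phi ->
  (length phi < 2 ^ k)%nat ->
  exists w, run (formula_circ (length a) k phi) (a ++ wires false (zeros (2 * k))) = a ++ w
    /\ (w = zeros (4 * k + 1) <-> sat a phi = true).
Proof.
  intros H Hm. rewrite run_formula by exact H. eexists. split; [reflexivity|].
  rewrite <- wires_zeros. replace (2 * k)%nat with (k + k)%nat by lia.
  replace (zeros (k + k)) with (zeros k ++ zeros k) by (symmetry; apply repeat_app).
  rewrite sat_count_unsat, Nat.eqb_eq. split.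
  - intros E. apply (iter_incr_zeros k).
    + unfold count_unsat. eapply Nat.le_lt_trans; [apply filter_length_le | exact Hm].
    + assert (I : forall rs ts, wires false rs = wires false ts -> rs = ts).
      { intros rs. induction rs as [|r rs IH]; intros [|t ts] W; try reflexivity;
          try discriminate.
        rewrite !wires_cons in W. injection W as <- W. f_equal. apply IH.
        unfold wires. now f_equal. }
      apply I in E. now apply app_inv_head in E.
  - intros ->. reflexivity.
Qed.

(** * Hadamard layers *)

Definition layer (n : nat) : circuit := map GH (seq 0 n).

Definition sumR (l : list R) : R := fold_right Rplus 0 l.

Lemma sumR_app l1 l2 : sumR (l1 ++ l2) = sumR l1 + sumR l2.
Proof. induction l1; simpl; lra. Qed.

Lemma sumR_scale c l : sumR (map (Rmult c) l) = c * sumR l.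
Proof. induction l as [|x l IH]; simpl; [lra|]. rewrite IH. lra. Qed.

Lemma apply_GH a v w psi :
  apply_gate (GH (length a)) psi (a ++ v :: w) =
  (RtoC (/ sqrt 2) * (psi (a ++ false :: w)
     + (if v then RtoC (-1) else RtoC 1) * psi (a ++ true :: w)))%C.
Proof.
  unfold apply_gate.
  pose proof (fun x => set_bit_app a (v :: w) 0 x) as S.
  pose proof (bit_app a (v :: w) 0) as B.
  rewrite Nat.add_0_r in B, S. now rewrite !S, B.
Qed.

Arguments apply_gate : simpl never.

(** The bra side of a Hadamard layer: all signs are positive at the zero string. The prefix [a]
    holds the qubits already treated, and each Hadamard merges the two values of one bit. *)
Lemma layer_sum_gen n a w psi f :
  (forall z, length z = n -> psi (a ++ z ++ w) = RtoC (f z)) ->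
  apply_circuit (map GH (seq (length a) n)) psi (a ++ zeros n ++ w)
  = RtoC ((/ sqrt 2) ^ n * sumR (map f (bitstrings n))).
Proof.
  revert a psi f. induction n as [|n IH]; intros a psi f H.
  - specialize (H [] eq_refl). simpl in H |- *. rewrite H. f_equal. lra.
  - simpl map at 1.
    change (apply_circuit (?g :: ?c) psi) with (apply_circuit c (apply_gate g psi)).
    specialize (IH (a ++ [false]) (apply_gate (GH (length a)) psi)
      (fun z => / sqrt 2 * (f (false :: z) + f (true :: z)))).
    rewrite length_app, Nat.add_comm, <- !app_assoc in IH. simpl in IH.
    change (zeros (S n) ++ w) with (false :: zeros n ++ w). rewrite IH.
    + f_equal. simpl. rewrite map_app, sumR_app, !map_map.
      rewrite <- map_map with (g := Rmult (/ sqrt 2))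
        (f := fun z => f (false :: z) + f (true :: z)).
      rewrite sumR_scale.
      assert (E : forall l, sumR (map (fun z => f (false :: z) + f (true :: z)) l)
        = sumR (map (fun z => f (false :: z)) l) + sumR (map (fun z => f (true :: z)) l)).
      { intros l. induction l as [|z l IHl]; simpl; [lra|]. rewrite IHl. lra. }
      rewrite E. ring.
    + intros z Hz. rewrite <- app_assoc. simpl. rewrite apply_GH.
      pose proof (H (false :: z)) as H0. pose proof (H (true :: z)) as H1.
      simpl in H0, H1. rewrite H0, H1 by now rewrite Hz.
      rewrite RtoC_mult, RtoC_plus. ring.
Qed.

(** The ket side: [all1 (map negb z)] tests that [z] is zero. Only the branch with bit [false]
    contributes, so no sign appears. *)
Lemma layer_ket_gen n a w psi c :
  (forall z, length z = n -> psi (a ++ z ++ w) = RtoC (if all1 (map negb z) then c else 0)) ->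
  forall y, length y = n ->
  apply_circuit (map GH (seq (length a) n)) psi (a ++ y ++ w)
  = RtoC ((/ sqrt 2) ^ n * c).
Proof.
  revert a psi c. induction n as [|n IH]; intros a psi c H y Hy.
  - destruct y; [|discriminate]. specialize (H [] eq_refl). simpl in H |- *. rewrite H. f_equal. lra.
  - destruct y as [|v y]; [discriminate|]. injection Hy as Hy. simpl map.
    change (apply_circuit (?g :: ?d) psi) with (apply_circuit d (apply_gate g psi)).
    specialize (IH (a ++ [v]) (apply_gate (GH (length a)) psi) (/ sqrt 2 * c)).
    rewrite length_app, Nat.add_comm in IH. simpl length in IH.
    specialize (IH) with (2 := Hy). rewrite <- !app_assoc in IH. simpl in IH |- *.
    rewrite IH.
    + f_equal. ring.
    + intros z Hz. rewrite <- app_assoc. simpl. rewrite apply_GH.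
      pose proof (H (false :: z)) as H0. pose proof (H (true :: z)) as H1.
      simpl in H0, H1. rewrite H0, H1 by now rewrite Hz.
      fold (all1 (map negb z)). destruct (all1 (map negb z));
      rewrite ?RtoC_mult; ring.
Qed.

Definition full_circ (n k : nat) (phi : cnf) : circuit :=
  layer n ++ formula_circ n k phi ++ layer n.

Lemma sqrt2_pow n : (/ sqrt 2) ^ n * (/ sqrt 2) ^ n = / 2 ^ n.
Proof.
  rewrite <- Rpow_mult_distr, <- Rinv_mult, sqrt_sqrt by lra. apply pow_inv.
Qed.

Lemma sumR_filter (P : list bool -> bool) c l :
  sumR (map (fun z => if P z then c else 0) l) = c * INR (length (filter P l)).
Proof.
  induction l as [|z l IH]; simpl sumR; [simpl; lra|]. rewrite IH. simpl filter.
  destruct (P z); [|lra]. simpl length. rewrite S_INR. lra.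
Qed.

Lemma all1_negb z : all1 (map negb z) = true <-> z = zeros (length z).
Proof.
  induction z as [|v z IH]; simpl; [tauto|]. fold (all1 (map negb z)).
  rewrite andb_true_iff, IH. destruct v; simpl; split.
  - intros [? _]. discriminate.
  - discriminate.
  - intros [_ E]. change (false :: z = false :: zeros (length z)). now f_equal.
  - intros E. injection E as E. split; [reflexivity | exact E].
Qed.

Lemma app_inj_length {A} (a b c d : list A) :
  length a = length c -> a ++ b = c ++ d -> a = c /\ b = d.
Proof.
  revert c. induction a as [|x a IH]; intros [|y c] L E; simpl in *; try discriminate.
  - now split.
  - injection E as -> E. destruct (IH c) as [-> ->]; [lia | exact E | now split].
Qed.

Lemma amplitude_full n k phi :
  Forall classical (formula_circ n k phi) ->
  Forall (fun cl => Forall (fun l : literal => (snd l < n)%nat) cl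
                    /\ (length cl < 2 ^ k)%nat) phi ->
  (length phi < 2 ^ k)%nat ->
  amplitude (n + (4 * k + 1)) (full_circ n k phi) (zeros (n + (4 * k + 1)))
  = RtoC (INR (count_sat n phi) / 2 ^ n).
Proof.
  intros Hcl Hphi Hm. unfold amplitude, full_circ, layer.
  rewrite !apply_circuit_app. unfold zeros. rewrite repeat_app.
  fold (zeros n). fold (zeros (4 * k + 1)).
  set (psi1 := apply_circuit (map GH (seq 0 n)) (ket _)).
  (* After the first layer the state is uniform on the variables and still zero on the ancillas. *)
  assert (E1 : forall y w, length y = n ->
    psi1 (y ++ w) = RtoC ((/ sqrt 2) ^ n *
       (if list_eq_dec bool_dec w (zeros (4 * k + 1)) then 1 else 0))).
  { intros y w Hy. unfold psi1.
    apply (layer_ket_gen n [] w); [|exact Hy]. intros z Hz. cbn [app]. unfold ket.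
    assert (Hzn : length (zeros n) = length z) by (now rewrite zeros_length).
    destruct (list_eq_dec bool_dec (zeros n ++ zeros (4 * k + 1)) (z ++ w)) as [E|E].
    - apply app_inj_length in E; [|exact Hzn]. destruct E as [E <-].
      destruct (all1 (map negb z)) eqn:A.
      + destruct (list_eq_dec _ _ _); [reflexivity|tauto].
      + exfalso. rewrite <- E in A. assert (C : all1 (map negb (zeros n)) = true).
        { apply all1_negb. unfold zeros. now rewrite repeat_length. }
        congruence.
    - destruct (all1 (map negb z)) eqn:A; [|reflexivity].
      destruct (list_eq_dec _ _ _) as [->|_]; [|reflexivity].
      apply all1_negb in A. rewrite Hz in A. now subst z. }
  rewrite (layer_sum_gen n [] (zeros (4 * k + 1)) _
    (fun z => if sat z phi then (/ sqrt 2) ^ n else 0)).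
  - f_equal. rewrite sumR_filter. fold (count_sat n phi).
    rewrite <- Rmult_assoc, sqrt2_pow. unfold Rdiv. ring.
  (* The amplitude at [z] with zero ancillas is that of [psi1] at the pulled-back basis state, whose
     ancillas are zero iff [z] satisfies the formula. *)
  - intros z Hz. cbn [app]. rewrite apply_classical by exact Hcl. subst n.
    rewrite <- wires_zeros.
    destruct (run_formula_zeros z k phi Hphi Hm) as (w & -> & Hw).
    rewrite E1 by reflexivity. f_equal.
    destruct (list_eq_dec _ _ _) as [E|E]; destruct (sat z phi); try lra.
    + apply Hw in E. discriminate.
    + tauto.
Qed.

(** * The reduction as a program *)

Notation "c ;; d" := (Seq c d) (at level 80, right associativity).

Fixpoint add_expr (m : nat) (e : expr) : expr :=
  match m with O => e | S m' => Cons Nil (add_expr m' e) end.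

Definition gate_expr (tag : nat) (qs : list expr) : expr :=
  Cons (add_expr tag Nil) (fold_right Cons Nil qs).

(* Memory layout: 0 circuit, 1 number of variables, 2 clauses, 3 k, 4 2k,
   5 the k-digit incrementation, 6 and 7 the reversed k- and 2k-digit ones,
   8 first free wire, 9-12 temporaries, 13 current clause, 14 control gates. *)

(** Moving gates one by one reverses them, and each circuit is thus built from its last gate to its
    first. *)
Definition push (src : nat) : com :=
  Assign 12 (Var src);;
  While (Var 12)
    (Assign 0 (Cons (Hd (Var 12)) (Var 0));; Assign 12 (Tl (Var 12))).

Definition layer_com : com :=
  Assign 11 (Var 1);;
  While (Var 11)
    (Assign 11 (Tl (Var 11));;
     Assign 0 (Cons (gate_expr 0 [Var 11]) (Var 0))).

Definition ccx_expr : expr :=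
  gate_expr 4 [Var 8; add_expr 1 (Var 8); add_expr 2 (Var 8)].
Definition cx_expr : expr := gate_expr 3 [Var 8; add_expr 1 (Var 8)].

(** Unrolled, [incr_circ] is a run of [cx], [ccx] at growing positions followed by a run of [ccx] at
    falling ones. Variable 10 gathers the first run reversed, variable 9 the second; pushing either
    onto the other gives the circuit and its reverse. *)
Definition incr_com (kv : nat) : com :=
  Assign 8 (Var 1);; Assign 9 Nil;; Assign 10 Nil;; Assign 11 (Var kv);;
  While (Var 11)
    (Assign 9 (Cons ccx_expr (Var 9));;
     Assign 10 (Cons ccx_expr (Cons cx_expr (Var 10)));;
     Assign 8 (add_expr 2 (Var 8));;
     Assign 11 (Tl (Var 11)));;
  Assign 0 (Var 9);; push 10;; Assign 13 (Var 0);;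
  Assign 0 (Var 10);; push 9;; Assign 10 (Var 0);; Assign 9 (Var 13);; Assign 13 Nil.

(** Since [Tl] of a leaf is a leaf, odd lengths are rounded up. *)
Definition halve_com : com :=
  Assign 10 Nil;;
  While (Var 9) (Assign 9 (Tl (Tl (Var 9)));; Assign 10 (Cons Nil (Var 10)));;
  Assign 9 (Var 10).

(** The list in variable 9 starts with length [m + 2n + 1], for [m] clauses and [n] variables, and
    is halved until its length is 1; [k] is the number of halvings. *)
Definition log_com : com :=
  Assign 9 (Cons Nil (Var 2));; Assign 11 (Var 1);;
  While (Var 11) (Assign 9 (add_expr 2 (Var 9));; Assign 11 (Tl (Var 11)));;
  While (Tl (Var 9))
    (halve_com;; Assign 3 (Cons Nil (Var 3));; Assign 4 (add_expr 2 (Var 4))).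

Definition add_ctrl_com (jv : nat) : com := push 14;; push jv;; push 14.

Definition not_expr : expr := gate_expr 2 [Var 1].
Definition cnot_expr : expr := gate_expr 3 [Tl (Hd (Var 11)); Var 1].

Definition pass_com (jv : nat) : com :=
  Assign 11 (Var 13);;
  While (Var 11)
    (If (Hd (Hd (Var 11)))
        (Assign 14 (Cons cnot_expr Nil))
        (Assign 14 (Cons cnot_expr (Cons not_expr Nil)));;
     add_ctrl_com jv;;
     Assign 11 (Tl (Var 11)));;
  Assign 14 Nil.

Definition clause_com : com :=
  Assign 13 (Hd (Var 2));; Assign 14 (Cons not_expr Nil);; add_ctrl_com 5;;
  pass_com 6;;
  Assign 14 (Cons not_expr Nil);; add_ctrl_com 7;;
  pass_com 5;;
  Assign 13 Nil;; Assign 2 (Tl (Var 2)).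

(** The simulator expects a memory that is empty except for its input, so all scratch variables have
    to be reset. *)
Definition clear (xs : list nat) (c : com) : com :=
  fold_right (fun x c => Assign x Nil;; c) c xs.

Definition reduction_com : com :=
  Assign 1 (Hd (Var 0));; Assign 2 (Tl (Var 0));;
  log_com;;
  incr_com 3;; Assign 5 (Var 9);; Assign 6 (Var 10);;
  incr_com 4;; Assign 7 (Var 10);;
  Assign 0 Nil;; layer_com;;
  While (Var 2) clause_com;;
  layer_com;;
  clear [1; 3; 4; 5; 6; 7; 9; 10]%nat
    (* As [false] is encoded by a leaf, the unary number of qubits is also the encoding of the
       all-zero string [x]. *)
    (Assign 0 (Cons (add_expr 1 (Var 8)) (Cons (Var 0) (add_expr 1 (Var 8))));;
     Assign 8 Nil).

Arguments mk _ _ /.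
Notation gates := (tree_of_list tree_of_gate).

Ltac assign := first
  [ eapply runs_seq; [apply runs_assign_mk | cbn [put eval mk nth]]
  | apply runs_assign_mk ].

Lemma fold_left_cons {A} (xs acc : list A) :
  fold_left (fun s x => x :: s) xs acc = rev xs ++ acc.
Proof.
  revert acc. induction xs as [|x xs IH]; intros acc; simpl; [reflexivity|].
  now rewrite IH, <- app_assoc.
Qed.

Lemma runs_push src xs acc a1 a2 a3 a4 a5 a6 a7 a8 a9 a10 a11 a12 a13 a14 :
  nth src [gates acc;a1;a2;a3;a4;a5;a6;a7;a8;a9;a10;a11;a12;a13;a14] Leaf = gates xs ->
  runs (push src) (mk [gates acc;a1;a2;a3;a4;a5;a6;a7;a8;a9;a10;a11;a12;a13;a14])
   (mk [gates (rev xs ++ acc);a1;a2;a3;a4;a5;a6;a7;a8;a9;a10;a11;Leaf;a13;a14])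
   (4 * length xs + 3).
Proof.
  intros E. eapply runs_weaken; [|unfold push; eapply runs_seq; [apply runs_assign_mk|]].
  2:{ change (eval (mk ?l) (Var src)) with (nth src l Leaf). rewrite E, <- fold_left_cons. cbn [put].
      apply (runs_for tree_of_gate 12 _
        (fun u s => [gates s;a1;a2;a3;a4;a5;a6;a7;a8;a9;a10;a11;u;a13;a14])
        (fun s x => x :: s) 3).
      - reflexivity.
      - intros x u s _. eapply runs_weaken; [|assign; assign]. lia. }
  lia.
Qed.

Lemma runs_layer n acc a2 a3 a4 a5 a6 a7 a8 a9 a10 a11 a12 a13 a14 :
  runs layer_com
    (mk [gates acc;tree_of_nat n;a2;a3;a4;a5;a6;a7;a8;a9;a10;a11;a12;a13;a14])
    (mk [gates (layer n ++ acc);tree_of_nat n;a2;a3;a4;a5;a6;a7;a8;a9;a10;Leaf;a12;a13;a14])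
    (4 * n + 3).
Proof.
  eapply runs_weaken; [|unfold layer_com; assign].
  (* Variable 1 stays fixed while its copy in variable 11 shrinks during the induction. *)
  2:{ generalize (tree_of_nat n) at 1 3 as a1. revert acc.
      instantiate (1 := (4 * n + 1)%nat).
      induction n as [|n IH]; intros acc a1.
      - apply runs_while_leaf. reflexivity.
      - eapply runs_weaken; [|eapply runs_while_node].
        3:{ eapply runs_weaken; [|assign; assign]. apply (le_n 3). }
        3:{ unfold layer. rewrite seq_S, map_app, <- app_assoc. cbn [put eval mk nth Nat.add].
            apply (IH (GH n :: acc)). }
        + lia.
        + reflexivity. }
  lia.
Qed.

Lemma runs_add_ctrl jv p J acc a1 a2 a3 a4 a5 a6 a7 a8 a9 a10 a11 a12 a13 :
  (2 <= jv <= 11)%nat ->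
  nth jv [gates acc;a1;a2;a3;a4;a5;a6;a7;a8;a9;a10;a11;a12;a13;gates p] Leaf = gates J ->
  (length p <= 2)%nat ->
  runs (add_ctrl_com jv)
   (mk [gates acc;a1;a2;a3;a4;a5;a6;a7;a8;a9;a10;a11;a12;a13;gates p])
   (mk [gates (add_ctrl p J ++ acc);a1;a2;a3;a4;a5;a6;a7;a8;a9;a10;a11;Leaf;a13;gates p])
   (4 * length J + 27).
Proof.
  intros Hjv HJ Hp. unfold add_ctrl_com, add_ctrl. rewrite <- !app_assoc.
  eapply runs_weaken; [|eapply runs_seq; [apply runs_push; reflexivity|
    eapply runs_seq; [apply runs_push | apply runs_push; reflexivity]]].
  2:{ rewrite <- HJ. do 12 (destruct jv; [reflexivity || lia|]). lia. }
  lia.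
Qed.

Lemma fold_left_flat_map {A B} (f : A -> list B) xs acc :
  fold_left (fun s x => f x ++ s) xs acc = flat_map f (rev xs) ++ acc.
Proof.
  revert acc. induction xs as [|x xs IH]; intros acc; simpl; [reflexivity|].
  rewrite IH, flat_map_app, <- app_assoc. simpl. now rewrite app_nil_r.
Qed.

Lemma runs_pass n jv J cl acc a2 a3 a4 a5 a6 a7 a8 a9 a10 a11 a14 :
  (2 <= jv <= 10)%nat ->
  nth jv [Leaf;Leaf;a2;a3;a4;a5;a6;a7;a8;a9;a10] Leaf = gates J ->
  runs (pass_com jv)
   (mk [gates acc;tree_of_nat n;a2;a3;a4;a5;a6;a7;a8;a9;a10;a11;Leaf;
        tree_of_list tree_of_literal cl;a14])
   (mk [gates (flat_map (fun l => add_ctrl (lit_circ n l) J) (rev cl) ++ acc);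
        tree_of_nat n;a2;a3;a4;a5;a6;a7;a8;a9;a10;Leaf;Leaf;
        tree_of_list tree_of_literal cl;Leaf])
   (length cl * (4 * length J + 33) + 5).
Proof.
  intros Hjv HJ.
  (* Variable 14 keeps the control gates of the last literal, so the loop state includes it; [E]
     drops it, as the pass clears it in the end. *)
  pose (g := fun (s : circuit * tree) l =>
     (add_ctrl (lit_circ n l) J ++ fst s, gates (lit_circ n l))).
  assert (E : forall cl p, fst (fold_left g cl (acc, p)) =
    flat_map (fun l => add_ctrl (lit_circ n l) J) (rev cl) ++ acc).
  { intros ls p. rewrite <- fold_left_flat_map. revert acc p.
    induction ls as [|l ls IH]; intros acc p; simpl; [reflexivity|]. apply IH. }
  rewrite <- (E cl a14).
  unfold pass_com. set (body := If _ _ _ ;; _).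
  assert (Hloop := runs_for tree_of_literal 11 body
    (fun u s => [gates (fst s);tree_of_nat n;a2;a3;a4;a5;a6;a7;a8;a9;a10;u;
       Leaf;tree_of_list tree_of_literal cl;snd s])
    g (4 * length J + 32) cl (acc, a14)).
  eapply runs_weaken; [|assign; eapply runs_seq; [apply Hloop|apply runs_assign_mk]].
  - lia.
  - reflexivity.
  - intros l u [c b14] _. cbn [fst snd g]. unfold body.
    eapply runs_weaken; [|eapply runs_seq; [eapply runs_if with
      (s' := mk [gates c;tree_of_nat n;a2;a3;a4;a5;a6;a7;a8;a9;a10;
        Node (tree_of_literal l) u;Leaf;tree_of_list tree_of_literal cl;
        gates (lit_circ n l)]) |
      eapply runs_seq; [apply (runs_add_ctrl _ _ J) | assign]]].
    + instantiate (1 := 1%nat). lia.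
    + destruct l as [[|] v]; cbn [eval mk nth tree_of_literal fst tree_of_bool is_leaf];
        assign.
    + lia.
    + rewrite <- HJ. do 11 (destruct jv; [reflexivity || lia|]). lia.
    + unfold lit_circ. destruct (fst l); simpl; lia.
Qed.

Lemma incr_circ_length q k : length (incr_circ q k) = (3 * k)%nat.
Proof.
  revert q. induction k as [|k IH]; intros q; [reflexivity|].
  simpl incr_circ. simpl length. rewrite length_app, IH. simpl. lia.
Qed.

Lemma runs_clause n k cl u acc a3 a4 a8 a9 a10 :
  runs clause_com
   (mk [gates acc;tree_of_nat n;Node (tree_of_list tree_of_literal cl) u;a3;a4;
        gates (incr_circ n k);gates (rev (incr_circ n k));
        gates (rev (incr_circ n (2 * k)));a8;a9;a10;Leaf;Leaf;Leaf;Leaf])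
   (mk [gates (clause_circ n k cl ++ acc);tree_of_nat n;u;a3;a4;
        gates (incr_circ n k);gates (rev (incr_circ n k));
        gates (rev (incr_circ n (2 * k)));a8;a9;a10;Leaf;Leaf;Leaf;Leaf])
   (length cl * (24 * k + 66) + 36 * k + 100).
Proof.
  unfold clause_circ. rewrite <- !app_assoc.
  assert (X : gates [GX n] = Node (tree_of_gate (GX n)) Leaf) by reflexivity.
  assert (L1 : (length [GX n] <= 2)%nat) by (simpl; lia).
  pose proof (incr_circ_length n) as L.
  eapply runs_weaken; [|unfold clause_com; assign; assign;
    eapply runs_seq; [apply (runs_add_ctrl 5 [GX n] (incr_circ n k)); auto; lia|];
    eapply runs_seq; [apply (runs_pass n 6 (rev (incr_circ n k)) cl); auto; lia|];
    assign;
    eapply runs_seq; [apply (runs_add_ctrl 7 [GX n] (rev (incr_circ n (2 * k)))); auto; lia|];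
    eapply runs_seq; [apply (runs_pass n 5 (incr_circ n k) cl); auto; lia|];
    assign; assign].
  rewrite !length_rev, !L. lia.
Qed.

Definition incr_step (s : nat * list (gate nat) * list (gate nat)) (_ : unit) :=
  let '(q, f, g) := s in (S (S q), ccx q :: f, ccx q :: cx q :: g).

Lemma incr_com_loop q k f g :
  exists F G, fold_left incr_step (repeat tt k) (q, f, g)
    = ((q + 2 * k)%nat, F ++ f, G ++ g) /\ rev G ++ F = incr_circ q k.
Proof.
  revert q f g. induction k as [|k IH]; intros q f g.
  - exists [], []. simpl. now rewrite Nat.add_0_r.
  - destruct (IH (S (S q)) (ccx q :: f) (ccx q :: cx q :: g)) as (F & G & E & EI).
    exists (F ++ [ccx q]), (G ++ [ccx q; cx q]). split.
    + refine (eq_trans E _). rewrite <- !app_assoc. simpl. do 2 f_equal. lia.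
    + simpl. rewrite rev_app_distr, <- EI. simpl. now rewrite !app_assoc.
Qed.

Lemma runs_incr_com kv n k a0 a2 a3 a4 a5 a6 a7 a8 a9 a10 a11 a12 a13 a14 :
  (3 <= kv <= 4)%nat -> nth kv [a0;a0;a0;a3;a4] Leaf = tree_of_nat k ->
  exists a0',
  runs (incr_com kv)
   (mk [a0;tree_of_nat n;a2;a3;a4;a5;a6;a7;a8;a9;a10;a11;a12;a13;a14])
   (mk [a0';tree_of_nat n;a2;a3;a4;a5;a6;a7;tree_of_nat (n + 2 * k);
        gates (incr_circ n k);gates (rev (incr_circ n k));Leaf;Leaf;Leaf;a14])
   (20 * k + 30).
Proof.
  intros Hkv Ek. destruct (incr_com_loop n k [] []) as (F & G & E & EI).
  rewrite !app_nil_r in E.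
  pose proof (f_equal (@length _) EI) as L. rewrite length_app, length_rev, incr_circ_length in L.
  exists (gates (rev F ++ G)). unfold incr_com. set (body := Assign 9 (Cons _ _) ;; _).
  pose (emb := fun (u : tree) (s : nat * list (gate nat) * list (gate nat)) =>
    let '(q, f, g) := s in
    [a0;tree_of_nat n;a2;a3;a4;a5;a6;a7;tree_of_nat q;gates f;gates g;u;a12;a13;a14]).
  assert (Hloop : runs (While (Var 11) body) (mk (emb (tree_of_nat k) (n, [], [])))
    (mk (emb Leaf (fold_left incr_step (repeat tt k) (n, [], []))))
    (length (repeat tt k) * (7 + 1) + 1)).
  { apply (runs_for (fun _ => Leaf)).
    - now intros u [[q f] g].
    - intros [] u [[q f] g] _. unfold body, emb, incr_step.
      eapply runs_weaken; [|assign; assign; assign; assign]. lia. }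
  rewrite E, repeat_length in Hloop. unfold emb in Hloop.
  assert (R : rev (incr_circ n k) = rev F ++ G)
    by (rewrite <- EI, rev_app_distr, rev_involutive; reflexivity).
  rewrite R, <- EI.
  assert (Hk : kv = 3%nat \/ kv = 4%nat) by lia.
  eapply runs_weaken; [|assign; assign; assign; eapply runs_seq; [apply runs_assign_mk|]].
  2:{ replace (eval _ (Var kv)) with (tree_of_nat k)
        by (rewrite <- Ek; destruct Hk as [-> | ->]; reflexivity).
      cbn [put]. eapply runs_seq; [exact Hloop|]. assign.
      eapply runs_seq; [apply runs_push; reflexivity|]. assign. assign.
      eapply runs_seq; [apply runs_push; reflexivity|]. assign. assign. assign. }
  lia.
Qed.

(** Only lengths are tracked, because the list to be halved at first contains the encoded clauses
    and not just leaves. *)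
Lemma runs_halve_loop a0 a1 a2 a3 a4 a5 a6 a7 a8 u v a11 a12 a13 a14 :
  exists v', nat_of_tree v' = (nat_of_tree v + (nat_of_tree u + 1) / 2)%nat /\
  runs (While (Var 9) (Assign 9 (Tl (Tl (Var 9)));; Assign 10 (Cons Nil (Var 10))))
   (mk [a0;a1;a2;a3;a4;a5;a6;a7;a8;u;v;a11;a12;a13;a14])
   (mk [a0;a1;a2;a3;a4;a5;a6;a7;a8;Leaf;v';a11;a12;a13;a14])
   (4 * nat_of_tree u + 1).
Proof.
  remember (nat_of_tree u) as m eqn:Em. revert u v Em.
  induction m as [m IH] using lt_wf_ind. intros u v Em.
  destruct u as [|l u].
  - exists v. subst m. split; [simpl; lia|]. eapply runs_weaken;
      [|apply runs_while_leaf; reflexivity]. lia.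
  - pose (u' := match u with Leaf => Leaf | Node _ r => r end).
    destruct (IH (nat_of_tree u')) with (u := u') (v := Node Leaf v) as (v' & Ev & R);
      [subst m u'; destruct u; simpl; lia | reflexivity |].
    exists v'. split.
    + rewrite Ev. subst m u'. destruct u as [|l' u]; cbn [nat_of_tree].
      * simpl. lia.
      * replace (S (S (nat_of_tree u)) + 1)%nat with (nat_of_tree u + 1 + 1 * 2)%nat by lia.
        rewrite Nat.div_add by lia. lia.
    + eapply runs_weaken; [|eapply runs_while_node; [reflexivity| |exact R]].
      2:{ eapply runs_weaken; [|assign; assign]. apply (le_n 3). }
      subst m u'. destruct u; simpl; lia.
Qed.

(** For the length minus one, halving with rounding up becomes division by two with rounding down.
    The costs form a geometric series, hence the linear bound. *)
Lemma runs_log_loop m a0 a1 a2 j a5 a6 a7 a8 u a10 a11 a12 a13 a14 :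
  nat_of_tree u = S m ->
  exists k u' a10', (S m <= 2 ^ k)%nat /\ (2 ^ k <= Nat.max 1 (2 * m))%nat /\
  runs (While (Tl (Var 9))
    (halve_com;; Assign 3 (Cons Nil (Var 3));; Assign 4 (add_expr 2 (Var 4))))
   (mk [a0;a1;a2;tree_of_nat j;tree_of_nat (2 * j);a5;a6;a7;a8;u;a10;a11;a12;a13;a14])
   (mk [a0;a1;a2;tree_of_nat (j + k);tree_of_nat (2 * (j + k));a5;a6;a7;a8;u';a10';a11;a12;a13;a14])
   (40 * m + 1).
Proof.
  revert u j a10. induction m as [m IH] using lt_wf_ind. intros u j a10 Em.
  destruct m as [|m].
  - exists 0%nat, u, a10. rewrite Nat.add_0_r. simpl. split; [lia|]. split; [lia|].
    apply runs_while_leaf. destruct u as [|l [|]]; simpl in *; lia || reflexivity.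
  - destruct (runs_halve_loop a0 a1 a2 (tree_of_nat j) (tree_of_nat (2 * j)) a5 a6 a7 a8 u
      Leaf a11 a12 a13 a14) as (v & Ev & R).
    pose (m' := ((m + 1) / 2)%nat).
    assert (Hm' : (2 * m' <= m + 1 <= 2 * m' + 1)%nat).
    { unfold m'. pose proof (Nat.div_mod (m + 1) 2).
      pose proof (Nat.mod_upper_bound (m + 1) 2). lia. }
    assert (Ev' : nat_of_tree v = S m').
    { rewrite Ev, Em. cbn [nat_of_tree].
      replace (S (S m) + 1)%nat with (m + 1 + 1 * 2)%nat by lia.
      rewrite Nat.div_add by lia. unfold m'. lia. }
    destruct (IH m') with (u := v) (j := S j) (a10 := v) as (k & u' & v' & K1 & K2 & R');
      [lia | exact Ev' |].
    exists (S k), u', v'. cbn [Nat.pow]. split; [lia|]. split; [lia|].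
    replace (j + S k)%nat with (S j + k)%nat by lia.
    eapply runs_weaken; [|eapply runs_while_node; [| |exact R']].
    + instantiate (1 := (4 * (m + 2) + 9)%nat). lia.
    + destruct u as [|l [|]]; simpl in *; lia || reflexivity.
    + unfold halve_com. replace (2 * S j)%nat with (S (S (2 * j))) by lia.
      eapply runs_weaken; [|eapply runs_seq; [assign; eapply runs_seq;
        [exact R | apply runs_assign_mk] | assign; apply runs_assign_mk]].
      rewrite Em. lia.
Qed.

Lemma runs_log_com n F a0 a5 a6 a7 a8 a9 a10 a11 a12 a13 a14 :
  exists k a9' a10', let s := (nat_of_tree F + 2 * n + 1)%nat in
  (s <= 2 ^ k)%nat /\ (2 ^ k <= 2 * s)%nat /\
  runs log_com (mk [a0;tree_of_nat n;F;Leaf;Leaf;a5;a6;a7;a8;a9;a10;a11;a12;a13;a14])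
   (mk [a0;tree_of_nat n;F;tree_of_nat k;tree_of_nat (2 * k);a5;a6;a7;a8;a9';a10';Leaf;a12;a13;a14])
   (50 * s).
Proof.
  pose (g := fun u (_ : unit) => Node Leaf (Node Leaf u)).
  unfold log_com. set (body := Assign 9 _ ;; Assign 11 (Tl _)).
  assert (H1 := runs_for (fun _ : unit => Leaf) 11 body
    (fun u s => [a0;tree_of_nat n;F;Leaf;Leaf;a5;a6;a7;a8;s;a10;u;a12;a13;a14])
    g 3 (repeat tt n) (Node Leaf F)).
  set (x := fold_left g (repeat tt n) (Node Leaf F)) in *.
  assert (Ex : nat_of_tree x = S (nat_of_tree F + 2 * n)).
  { unfold x. generalize F as u. clear. induction n as [|n IH]; intros u; simpl; [lia|].
    unfold g at 2. rewrite (IH (Node Leaf (Node Leaf u))). simpl. lia. }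
  destruct (runs_log_loop _ a0 (tree_of_nat n) F 0 a5 a6 a7 a8 x a10 Leaf a12 a13 a14 Ex)
    as (k & a9' & a10' & K1 & K2 & R).
  exists k, a9', a10'. cbn zeta. split; [lia|]. split; [lia|].
  eapply runs_weaken; [|assign; assign; eapply runs_seq; [apply H1 | exact R]].
  - rewrite repeat_length. lia.
  - reflexivity.
  - intros [] u s _. unfold body. eapply runs_weaken; [|assign; assign]. lia.
Qed.

(** The lower bound on [2 ^ k] keeps the counters from overflowing; the upper bound makes the cost
    of the [4k + 1] extra qubits polynomial. *)
Lemma runs_reduction n phi L :
  Forall (fun cl : clause => (length cl <= L)%nat) phi ->
  exists k, let s := (length phi + 2 * n + 1)%nat in
  let N := (n + (4 * k + 1))%nat in
  (s <= 2 ^ k)%nat /\ (2 ^ k <= 2 * s)%nat /\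
  runs reduction_com
    (mk (Node (tree_of_nat n) (tree_of_list (tree_of_list tree_of_literal) phi)
         :: repeat Leaf 14))
    (mk (Node (tree_of_nat N) (Node (gates (full_circ n k phi)) (tree_of_nat N))
         :: repeat Leaf 14))
    (length phi * (L * (24 * k + 66) + 36 * k + 101) + 60 * k + 50 * s + 8 * n + 200).
Proof.
  intros HL. set (F := tree_of_list (tree_of_list tree_of_literal) phi).
  assert (EF : nat_of_tree F = length phi).
  { unfold F. clear. induction phi; simpl; [reflexivity|]. now f_equal. }
  set (w := Node _ F).
  destruct (runs_log_com n F w Leaf Leaf Leaf Leaf Leaf Leaf Leaf Leaf Leaf Leaf)
    as (k & x9 & x10 & K1 & K2 & R1).
  rewrite EF in K1, K2, R1. exists k. cbn zeta. split; [exact K1|]. split; [exact K2|].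
  destruct (runs_incr_com 3 n k w F (tree_of_nat k) (tree_of_nat (2 * k))
    Leaf Leaf Leaf Leaf x9 x10 Leaf Leaf Leaf Leaf) as (y & R2); [lia | reflexivity |].
  destruct (runs_incr_com 4 n (2 * k) y F (tree_of_nat k) (tree_of_nat (2 * k))
    (gates (incr_circ n k)) (gates (rev (incr_circ n k))) Leaf (tree_of_nat (n + 2 * k))
    (gates (incr_circ n k)) (gates (rev (incr_circ n k))) Leaf Leaf Leaf Leaf)
    as (z & R3); [lia | reflexivity |].
  (* The accumulator starts with the final Hadamard layer, since the circuit grows towards its
     front. *)
  assert (R4 := runs_for (X := clause) (tree_of_list tree_of_literal) 2 clause_com
    (fun u acc => [gates acc;tree_of_nat n;u;tree_of_nat k;tree_of_nat (2 * k);
      gates (incr_circ n k);gates (rev (incr_circ n k));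
      gates (rev (incr_circ n (2 * k)));tree_of_nat (n + 2 * (2 * k));
      gates (incr_circ n (2 * k));gates (rev (incr_circ n (2 * k)));Leaf;Leaf;Leaf;Leaf])
    (fun acc cl => clause_circ n k cl ++ acc) (L * (24 * k + 66) + 36 * k + 100)
    phi (layer n)).
  rewrite fold_left_flat_map in R4. fold (formula_circ n k phi) in R4.
  eapply runs_weaken; [|unfold reduction_com, clear; cbn [fold_right repeat];
    assign; assign; eapply runs_seq; [exact R1|];
    eapply runs_seq; [exact R2|]; assign; assign;
    eapply runs_seq; [exact R3|]; assign; assign;
    eapply runs_seq; [apply (runs_layer n [])|]; rewrite app_nil_r; eapply runs_seq; [apply R4|];
    [reflexivity| |]].
  3:{ eapply runs_seq; [apply runs_layer|]. do 9 assign.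
      (* Variable 8 stopped at the last carry wire, so the number of qubits is one more. *)
      replace (n + (4 * k + 1))%nat with (S (n + 2 * (2 * k))) by lia. assign. }
  - lia.
  - intros cl u acc Hin. rewrite Forall_forall in HL. specialize (HL cl Hin).
    eapply runs_weaken; [|apply runs_clause].
    apply (Nat.mul_le_mono_r _ _ (24 * k + 66)) in HL. lia.
Qed.

(** * Size of the circuit *)

Lemma incr_circ_ok N q k :
  (q + 2 * k < N)%nat ->
  Forall (fun g => classical g /\ gate_ok N g) (incr_circ q k).
Proof.
  revert q. induction k as [|k IH]; intros q H; simpl; [constructor|].
  assert (H1 : classical (ccx q) /\ gate_ok N (ccx q)).
  { split; [exact I|]. split; simpl.
    - repeat constructor; simpl; lia.
    - repeat constructor; lia. }
  assert (H2 : classical (cx q) /\ gate_ok N (cx q)).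
  { split; [exact I|]. split; simpl.
    - repeat constructor; simpl; lia.
    - repeat constructor; lia. }
  constructor; [exact H2|]. constructor; [exact H1|].
  apply Forall_app. split; [apply IH; lia|]. now constructor.
Qed.

Lemma formula_circ_ok n k phi :
  cnf_ok n phi ->
  Forall (fun g => classical g /\ gate_ok (n + (4 * k + 1)) g) (formula_circ n k phi).
Proof.
  intros H. set (N := (n + (4 * k + 1))%nat). set (P := fun g => _ /\ _).
  assert (A : forall p J, Forall P p -> Forall P J -> Forall P (add_ctrl p J)).
  { intros p J Hp HJ. unfold add_ctrl.
    repeat (apply Forall_app; split); now apply Forall_rev. }
  assert (HX : P (GX n)).
  { split; [exact I|]. split; repeat constructor; simpl; lia. }
  assert (HI : forall j, (j <= 2 * k)%nat -> Forall P (incr_circ n j)).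
  { intros j Hj. apply incr_circ_ok. unfold N. lia. }
  assert (HL : forall cl J, clause_ok n cl -> Forall P J ->
    Forall P (flat_map (fun l => add_ctrl (lit_circ n l) J) (rev cl))).
  { intros cl J [_ Hcl] HJ. apply Forall_flat_map, Forall_rev.
    eapply Forall_impl; [|exact Hcl]. intros [b v] Hv. simpl in Hv.
    apply A; [|exact HJ]. unfold lit_circ. simpl. constructor.
    - split; [exact I|]. split; repeat constructor; simpl; lia.
    - destruct b; [constructor | now constructor]. }
  unfold formula_circ. apply Forall_flat_map, Forall_rev.
  eapply Forall_impl; [|exact H]. intros cl Hcl. unfold clause_circ.
  apply Forall_app. split; [apply HL; [exact Hcl | apply HI; lia]|].
  apply Forall_app. split; [apply A; [now constructor | apply Forall_rev, HI; lia]|].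
  apply Forall_app. split; [apply HL; [exact Hcl | apply Forall_rev, HI; lia]|].
  apply A; [now constructor | apply HI; lia].
Qed.

Lemma full_circ_ok n k phi :
  cnf_ok n phi -> circuit_ok (n + (4 * k + 1)) (full_circ n k phi).
Proof.
  intros H. unfold circuit_ok, full_circ.
  assert (HL : Forall (gate_ok (n + (4 * k + 1))) (layer n)).
  { unfold layer. apply Forall_map, Forall_forall. intros i Hi. apply in_seq in Hi.
    split; repeat constructor; simpl; lia. }
  apply Forall_app. split; [exact HL|]. apply Forall_app. split; [|exact HL].
  eapply Forall_impl; [|apply formula_circ_ok, H]. now intros g [_ Hg].
Qed.

Lemma length_flat_map_le {A B} (f : A -> list B) b xs :
  (forall x, In x xs -> (length (f x) <= b)%nat) ->
  (length (flat_map f xs) <= length xs * b)%nat.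
Proof.
  induction xs as [|x xs IH]; intros H; simpl; [lia|]. rewrite length_app.
  pose proof (H x (or_introl eq_refl)). specialize (IH (fun y Hy => H y (or_intror Hy))).
  lia.
Qed.

(** Each literal is used in two passes of at most [3k + 4] gates; the two unconditional additions
    cost [6k + 2] and [3k + 2]. *)
Lemma full_circ_length n k phi L :
  Forall (fun cl : clause => (length cl <= L)%nat) phi ->
  (length (full_circ n k phi)
   <= length phi * (L * (6 * k + 8) + 9 * k + 4) + 2 * n)%nat.
Proof.
  intros H. unfold full_circ, layer, formula_circ.
  rewrite !length_app, !length_map, !length_seq.
  assert (HP : forall cl J, (length J = 3 * k)%nat ->
    (length (flat_map (fun l => add_ctrl (lit_circ n l) J) (rev cl))
     <= length cl * (3 * k + 4))%nat).
  { intros cl J HJ. rewrite <- (length_rev cl). apply length_flat_map_le.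
    intros l _. unfold add_ctrl, lit_circ. rewrite !length_app, !length_rev, HJ.
    destruct (fst l); simpl; lia. }
  pose proof (length_flat_map_le (clause_circ n k) (L * (6 * k + 8) + 9 * k + 4) (rev phi))
    as HF. rewrite length_rev in HF.
  enough (forall cl, In cl (rev phi) ->
    (length (clause_circ n k cl) <= L * (6 * k + 8) + 9 * k + 4)%nat) by
    (specialize (HF H0); lia).
  intros cl Hcl. apply in_rev in Hcl. rewrite Forall_forall in H. specialize (H cl Hcl).
  unfold clause_circ, add_ctrl at 2 4. rewrite !length_app, !length_rev, !incr_circ_length.
  pose proof (HP cl (incr_circ n k) (incr_circ_length n k)).
  pose proof (HP cl (rev (incr_circ n k))) as H1.
  rewrite length_rev, incr_circ_length in H1. specialize (H1 eq_refl).
  apply (Nat.mul_le_mono_r _ _ (6 * k + 8)) in H. simpl length. lia.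
Qed.

Lemma clause_length n cl : clause_ok n cl -> (length cl <= 2 * n)%nat.
Proof.
  intros [Hd Hv]. rewrite Forall_forall in Hv.
  replace (2 * n)%nat with (length (list_prod [true; false] (seq 0 n)))
    by (rewrite length_prod, length_seq; reflexivity).
  apply NoDup_incl_length; [exact Hd|]. intros [b v] Hin. apply in_prod.
  - destruct b; simpl; tauto.
  - apply in_seq. specialize (Hv _ Hin). simpl in Hv. lia.
Qed.

(** * Correctness *)

Lemma Cmod_RtoC_nonneg r : 0 <= r -> Cmod (RtoC r) = r.
Proof. intros H. rewrite Cmod_R. now apply Rabs_pos_eq. Qed.

Lemma bitstrings_card n : length (bitstrings n) = (2 ^ n)%nat.
Proof. induction n; simpl; [reflexivity|]. rewrite length_app, !length_map. lia. Qed.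

(** Three cases for the ratio: the digits are 1, 0 at one, 0, 1 on the rest of the upper half, and
    0, 0 below one half. *)
Lemma post_out_digits (a b : nat) :
  (a <= b)%nat -> (0 < b)%nat ->
  post_out (tree_of_list tree_of_bool (map (binary_digit (INR a / INR b)) (seq 0 2)))
  = tree_of_bool (b <=? 2 * a)%nat.
Proof.
  intros Hab Hb. set (r := INR a / INR b).
  assert (Pb : 0 < INR b) by now apply lt_0_INR.
  assert (Er : r * INR b = INR a) by (unfold r; field; lra).
  assert (H2 : INR (2 * a) = 2 * INR a) by (rewrite mult_INR; reflexivity).
  cbn [seq map]. unfold binary_digit.
  assert (D : forall z, r * 2 ^ 0 - 1 < IZR z <= r * 2 ^ 0 -> Int_part (2 ^ 0 * r) = z).
  { intros z [Hz1 Hz2]. symmetry. apply Int_part_spec. split; lra. }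
  assert (D' : forall z, 2 * r - 1 < IZR z <= 2 * r -> Int_part (2 ^ 1 * r) = z).
  { intros z [Hz1 Hz2]. symmetry. apply Int_part_spec. split; lra. }
  destruct (Nat.eq_dec a b) as [->|Hne].
  - replace (b <=? 2 * b)%nat with true by (symmetry; apply Nat.leb_le; lia).
    rewrite (D 1%Z). { reflexivity. }
    assert (r = 1) by (unfold r; field; lra). simpl. split; lra.
  - assert (r < 1).
    { assert (INR a < INR b) by (apply lt_INR; lia). nra. }
    assert (0 <= r) by (pose proof (pos_INR a); nra).
    rewrite (D 0%Z) by (simpl; split; lra).
    destruct (Nat.leb_spec b (2 * a)) as [Hle|Hlt].
    + rewrite (D' 1%Z). { reflexivity. }
      apply le_INR in Hle. rewrite H2 in Hle. split; [lra|nra].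
    + rewrite (D' 0%Z). { reflexivity. }
      apply lt_INR in Hlt. rewrite H2 in Hlt. split; [nra|lra].
Qed.

Lemma norm2_nonneg k psi : 0 <= norm2 k psi.
Proof.
  unfold norm2. induction (bitstrings k) as [|b l IH]; cbn [map fold_right]; [lra|].
  pose proof (pow2_ge_0 (Cmod (psi b))). lra.
Qed.

Lemma prob_mono (P Q : tree -> bool) t cf :
  (forall u, P u = true -> Q u = true) -> prob P t cf <= prob Q t cf.
Proof.
  intros H. revert cf. induction t as [|t IH]; intros [[|c L] s k psi]; simpl.
  1, 3: specialize (H (s O)); pose proof (norm2_nonneg k psi);
    destruct (P (s O)); [rewrite H by reflexivity; lra | destruct (Q (s O)); lra].
  - lra.
  - induction (step c L s k psi) as [|cf l IHl]; simpl; [lra|]. specialize (IH cf). lra.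
Qed.

Lemma start_mk A w : start A w = Config [A] (mk (w :: repeat Leaf 14)) 0 (ket []).
Proof.
  unfold start. f_equal. apply functional_extensionality. intros x. unfold upd, mk.
  destruct x as [|x]; [reflexivity|]. simpl Nat.eq_dec.
  destruct (Nat.eq_dec (S x) 0) as [E|_]; [discriminate|].
  do 15 (destruct x as [|x]; [reflexivity|]). now destruct x.
Qed.

Definition maj_com (A : com) : com := reduction_com;; A;; post.

Lemma prob_maj_com A w w' T :
  exec reduction_com (mk (w :: repeat Leaf 14)) (mk (w' :: repeat Leaf 14)) T ->
  forall P t, prob P (T + t + 4) (start (maj_com A) w)
    = prob (fun u => P (post_out u)) t (start A w').
Proof.
  intros H P t. rewrite !start_mk, <- prob_post.
  (* The four extra steps are two for unfolding the sequences and two for [post]. *)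
  replace (T + t + 4)%nat with (S (T + S (S (S t)))) by lia.
  unfold maj_com. cbn [prob todo step map fold_right mem nqubits qstate].
  rewrite Rplus_0_r, H. cbn [prob todo step map fold_right mem nqubits qstate].
  apply Rplus_0_r.
Qed.

Record sim_of (i : cnf_instance) (j : sim_instance) (k T : nat) : Prop := {
  sim_log : let s := (length (cnf_formula i) + 2 * cnf_vars i + 1)%nat in
    (s <= 2 ^ k <= 2 * s)%nat;
  sim_size : sim_qubits j = (cnf_vars i + (4 * k + 1))%nat;
  sim_length : (length (sim_circuit j) <= length (cnf_formula i)
    * (2 * cnf_vars i * (6 * k + 8) + 9 * k + 4) + 2 * cnf_vars i)%nat;
  sim_answer : post_out (answer (strong_simulation 2) j) = answer maj_cnfsat i;
  sim_exec : exec reduction_com (mk (encode maj_cnfsat i :: repeat Leaf 14))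
    (mk (encode (strong_simulation 2) j :: repeat Leaf 14)) T;
  sim_time : (T <= length (cnf_formula i)
    * (2 * cnf_vars i * (24 * k + 66) + 36 * k + 101) + 60 * k
    + 50 * (length (cnf_formula i) + 2 * cnf_vars i + 1) + 8 * cnf_vars i + 200)%nat
}.

Lemma sim_exists i : exists j k T, sim_of i j k T.
Proof.
  destruct i as [n phi wf].
  assert (HL : Forall (fun cl : clause => (length cl <= 2 * n)%nat) phi)
    by (eapply Forall_impl; [apply clause_length | exact wf]).
  destruct (runs_reduction n phi _ HL) as (k & K1 & K2 & T & HT & HE).
  set (N := (n + (4 * k + 1))%nat) in *.
  exists (SimInstance N (full_circ n k phi) (zeros N) (full_circ_ok n k phi wf)
    (zeros_length N)), k, T. split;
    cbn [sim_qubits sim_circuit sim_x cnf_vars cnf_formula answer encode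
         strong_simulation maj_cnfsat].
  - lia.
  - reflexivity.
  - now apply full_circ_length.
  - fold N. unfold N. rewrite amplitude_full.
    + rewrite Cmod_RtoC_nonneg by (apply Rmult_le_pos; [apply pos_INR |
        left; apply Rinv_0_lt_compat, pow_lt; lra]).
      change 2 with (INR 2). rewrite <- pow_INR. unfold maj.
      apply (post_out_digits (count_sat n phi) (2 ^ n)).
      * unfold count_sat. rewrite <- bitstrings_card. apply filter_length_le.
      * pose proof (Nat.pow_nonzero 2 n). lia.
    + eapply Forall_impl; [|apply formula_circ_ok, wf]. now intros g [Hg _].
    + eapply Forall_impl; [|apply (Forall_and wf HL)]. intros cl [[_ Hv] Hc].
      split; [exact Hv|]. lia.
    + lia.
  - replace (tree_of_list tree_of_bool (zeros N)) with (tree_of_nat N); [exact HE|].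
    generalize N as x. induction x as [|x IH]; [reflexivity|].
    change (Node Leaf (tree_of_nat x) = Node Leaf (tree_of_list tree_of_bool (zeros x))).
    now rewrite IH.
  - exact HT.
Qed.

Lemma maj_com_solves A D :
  solves A (strong_simulation 2) (fun _ => True) -> solves (maj_com A) maj_cnfsat D.
Proof.
  intros H i _. destruct (sim_exists i) as (j & k & T & S).
  destruct (H j I) as (t & H1 & H2). pose proof (prob_maj_com A _ _ T (sim_exec _ _ _ _ S)) as E.
  exists (T + t + 4)%nat. split.
  - unfold halts_within. rewrite E. exact H1.
  - rewrite E. eapply Rle_trans; [exact H2|]. apply prob_mono. intros u.
    destruct (tree_eq_dec u _) as [->|_]; [|discriminate]. intros _.
    rewrite (sim_answer _ _ _ _ S). now destruct (tree_eq_dec _ _).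
Qed.

(** * Running time *)

Lemma exp_pow_nat y k : exp y ^ k = exp (INR k * y).
Proof.
  induction k as [|k IH]; [simpl; now rewrite Rmult_0_l, exp_0|].
  rewrite S_INR, Rmult_plus_distr_r, exp_plus, Rmult_1_l, <- IH. simpl. ring.
Qed.

Lemma poly_le_exp a k :
  0 < a -> exists M, 0 < M /\ forall n : nat, INR n ^ k <= M * Rpower 2 (INR n * a).
Proof.
  intros Ha. assert (L2 : 0 < ln 2) by (rewrite <- ln_1; apply ln_increasing; lra).
  (* From [x <= exp x] one gets [n <= exp (n b) / b]; the [k]-th power stays below [2 ^ (n a)] up to
     a constant. Dividing by [S k] also covers [k = 0]. *)
  set (b := a * ln 2 / INR (S k)). pose proof (lt_0_INR (S k) (Nat.lt_0_succ k)) as Hk.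
  assert (Hb : 0 < b).
  { unfold b. apply Rdiv_lt_0_compat; [nra | exact Hk]. }
  exists ((/ b) ^ k). split; [apply pow_lt; now apply Rinv_0_lt_compat|]. intros n.
  assert (Hn : INR n <= / b * exp (INR n * b)).
  { apply (Rmult_le_reg_l b); [exact Hb|]. rewrite <- Rmult_assoc, Rinv_r by lra.
    pose proof (exp_ineq1_le (INR n * b)). lra. }
  apply Rle_trans with ((/ b * exp (INR n * b)) ^ k).
  - apply pow_incr. split; [apply pos_INR | exact Hn].
  - rewrite Rpow_mult_distr, exp_pow_nat. apply Rmult_le_compat_l.
    + apply pow_le. left. now apply Rinv_0_lt_compat.
    + unfold Rpower. apply Rnot_lt_le. intros Hlt. apply exp_lt_inv in Hlt.
      revert Hlt. apply Rle_not_lt.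
      replace (INR n * a * ln 2) with (INR (S k) * (INR n * b)) by (unfold b; field; lra).
      apply Rmult_le_compat_r; [|apply le_INR; lia].
      pose proof (pos_INR n). nra.
Qed.

(** The cubic bound absorbs [c] for large [n], so that later exponents do not depend on [c]. *)
Lemma few_clauses_size c : exists n0 : nat, forall n m : nat,
  (n0 <= n)%nat -> INR m <= c * INR n ^ 2 -> (m + 2 * n + 1 <= n ^ 3)%nat.
Proof.
  destruct (INR_unbounded (c + 3)) as [n0 H0]. exists (Nat.max 1 n0). intros n m Hn Hm.
  apply INR_le. rewrite !plus_INR, mult_INR, pow_INR. simpl (INR 1). simpl (INR 2).
  assert (H1 : 1 <= INR n) by (apply (le_INR 1); lia).
  assert (H2 : c + 3 <= INR n) by (assert (INR n0 <= INR n) by (apply le_INR; lia); lra).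
  assert (c * INR n ^ 2 + 2 * INR n + 1 <= (c + 3) * INR n ^ 2) by nra.
  assert ((c + 3) * INR n ^ 2 <= INR n ^ 3) by (simpl; nra). lra.
Qed.

(** With [s <= n ^ 3] and the crude [k <= 2 * s], both costs are at most [1000 * s ^ 3], and one
    factor [n] pays for the 1000. Moreover [2 ^ (4k + 1)] is at most [2 * (2 * s) ^ 4]. *)
Lemma sim_poly i j k T (n := cnf_vars i) :
  sim_of i j k T -> (1000 <= n)%nat ->
  (length (cnf_formula i) + 2 * n + 1 <= n ^ 3)%nat ->
  (length (sim_circuit j) <= n ^ 10)%nat /\ (T <= n ^ 10)%nat
  /\ (2 ^ (4 * k + 1) <= 32 * n ^ 12)%nat.
Proof.
  intros S Hn Hs. pose proof (sim_log _ _ _ _ S) as H1.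
  pose proof (sim_length _ _ _ _ S) as H2. pose proof (sim_time _ _ _ _ S) as H3.
  cbn zeta in H1. fold n in H1, H2, H3.
  set (m := length (cnf_formula i)) in *. set (s := (m + 2 * n + 1)%nat) in *.
  assert (Hk : (k <= 2 * s)%nat).
  { pose proof (Nat.pow_gt_lin_r 2 k). lia. }
  assert (Hm : (m <= s)%nat) by lia. assert (Hn' : (2 * n <= s)%nat) by lia.
  assert (Hs1 : (1 <= s)%nat) by lia. clearbody m.
  assert (P : (1000 * s ^ 3 <= n ^ 10)%nat).
  { replace (n ^ 10)%nat with (n * (n ^ 3) ^ 3)%nat
      by (rewrite <- Nat.pow_mul_r; reflexivity).
    apply Nat.mul_le_mono; [exact Hn|]. now apply Nat.pow_le_mono_l. }
  assert (Q1 : (s <= s * s)%nat) by nia.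
  assert (Q2 : (s * s <= s * s * s)%nat) by nia.
  assert (Q3 : (s ^ 3 = s * s * s)%nat) by (simpl; ring).
  split; [|split].
  - apply (Nat.le_trans _ _ _ H2). refine (Nat.le_trans _ _ _ _ P).
    apply Nat.le_trans with (s * (s * (6 * (2 * s) + 8) + 9 * (2 * s) + 4) + s)%nat.
    + apply Nat.add_le_mono; [|exact Hn']. apply Nat.mul_le_mono; [exact Hm|].
      repeat apply Nat.add_le_mono; try apply Nat.mul_le_mono; lia.
    + lia.
  - apply (Nat.le_trans _ _ _ H3). refine (Nat.le_trans _ _ _ _ P).
    apply Nat.le_trans with (s * (s * (24 * (2 * s) + 66) + 36 * (2 * s) + 101)
      + 60 * (2 * s) + 50 * s + 8 * s + 200)%nat.
    + repeat apply Nat.add_le_mono; try apply Nat.mul_le_mono; try lia.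
      repeat apply Nat.add_le_mono; try apply Nat.mul_le_mono; lia.
    + lia.
  - rewrite Nat.pow_add_r, Nat.mul_comm, (Nat.mul_comm 4), Nat.pow_mul_r.
    apply Nat.le_trans with (2 ^ 1 * (2 * n ^ 3) ^ 4)%nat.
    + apply Nat.mul_le_mono_l, Nat.pow_le_mono_l. lia.
    + rewrite Nat.pow_mul_l, <- Nat.pow_mul_r. apply Nat.eq_le_incl. simpl (2 ^ _)%nat.
      rewrite Nat.mul_assoc. reflexivity.
Qed.

(** The extra qubits enlarge the exponent by at most their number, hence the time by at most
    [2 ^ (4k + 1)]. *)
Lemma exp_time_sim delta e n k :
  e <= delta -> 0 <= e <= 1 -> (2 ^ (4 * k + 1) <= 32 * n ^ 12)%nat ->
  exp_time delta (n + (4 * k + 1)) <= exp_time e n * (32 * INR n ^ 12).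
Proof.
  intros He [He0 He1] H. unfold exp_time. set (K := (4 * k + 1)%nat) in *.
  apply Rle_trans with (Rpower 2 (INR n * (1 - e) + INR K)).
  - apply Rle_Rpower; [lra|]. rewrite plus_INR.
    pose proof (pos_INR n). pose proof (pos_INR K). nra.
  - rewrite Rpower_plus, Rpower_pow by lra. apply Rmult_le_compat_l.
    + left. apply exp_pos.
    + apply le_INR in H. rewrite pow_INR, mult_INR, pow_INR in H.
      replace (INR 32) with 32 in H by (simpl; ring). exact H.
Qed.

Lemma maj_com_time A delta c :
  0 < delta -> (forall d, time_O A (strong_simulation 2) (few_gates 2 d) (exp_time delta)) ->
  time_O (maj_com A) maj_cnfsat (few_clauses c) (exp_time (Rmin delta 1 / 2)).
Proof.
  intros Hd HA. destruct (HA 10%nat) as (B & n0 & HB).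
  set (e := Rmin delta 1).
  assert (He : e <= delta /\ 0 < e <= 1).
  { unfold e. pose proof (Rmin_l delta 1). pose proof (Rmin_r delta 1).
    pose proof (Rmin_glb_lt delta 1 0). lra. }
  destruct (few_clauses_size c) as [n1 Hn1].
  destruct (poly_le_exp (e / 2) 12) as (M & HM & Hpoly); [lra|].
  (* The first summand pays for the simulator, the second for the reduction and the four extra
     steps; [B] might be negative. *)
  exists (32 * Rabs B * M + 5 * M), (1000 + n0 + n1)%nat. intros i Hi Hn.
  simpl psize in *. destruct (sim_exists i) as (j & k & T & S).
  set (n := cnf_vars i) in *.
  destruct (sim_poly i j k T S) as (L1 & L2 & L3);
    [fold n; lia | apply Hn1; [fold n; lia | exact Hi] |]. fold n in L1, L2, L3.
  pose proof (sim_size _ _ _ _ S) as Hq. fold n in Hq.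
  destruct (HB j) as (t & Ht & Hh).
  - unfold few_gates. eapply Nat.le_trans; [exact L1|].
    apply Nat.pow_le_mono_l. lia.
  - simpl. lia.
  - exists (T + t + 4)%nat. split.
    2:{ unfold halts_within. rewrite (prob_maj_com A _ _ T (sim_exec _ _ _ _ S)). exact Hh. }
    simpl psize in Ht. rewrite Hq in Ht.
    (* Half of the saving [e] is spent on the polynomial factor. *)
    assert (Hsplit : exp_time e n * Rpower 2 (INR n * (e / 2)) = exp_time (e / 2) n).
    { unfold exp_time. rewrite <- Rpower_plus. f_equal. field. }
    (* This uses [e <= 1] and lets the polynomial time of the reduction fit under the bound. *)
    assert (Hhalf : Rpower 2 (INR n * (e / 2)) <= exp_time (e / 2) n).
    { unfold exp_time. apply Rle_Rpower; [lra|]. pose proof (pos_INR n). nra. }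
    assert (Ht' : INR t <= 32 * Rabs B * M * exp_time (e / 2) n).
    { pose proof (exp_time_sim delta e n k (proj1 He)) as HX.
      apply Rle_trans with (Rabs B * (exp_time e n * (32 * INR n ^ 12))).
      - apply (Rle_trans _ _ _ Ht). apply Rle_trans with (Rabs B * exp_time delta (n + (4 * k + 1))).
        + apply Rmult_le_compat_r; [left; apply exp_pos | apply Rle_abs].
        + apply Rmult_le_compat_l; [apply Rabs_pos|]. apply HX; [lra | exact L3].
      - rewrite <- Hsplit.
        replace (32 * Rabs B * M * (exp_time e n * Rpower 2 (INR n * (e / 2))))
          with (Rabs B * (exp_time e n * (32 * (M * Rpower 2 (INR n * (e / 2)))))) by ring.
        apply Rmult_le_compat_l; [apply Rabs_pos|].
        apply Rmult_le_compat_l; [left; apply exp_pos|].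
        specialize (Hpoly n). lra. }
    assert (HT : INR (T + 4) <= 5 * M * exp_time (e / 2) n).
    { apply Rle_trans with (INR (5 * n ^ 12)).
      - apply le_INR. assert (n ^ 10 <= n ^ 12)%nat by (apply Nat.pow_le_mono_r; lia).
        assert (1 <= n ^ 12)%nat by (apply (Nat.pow_le_mono_r n 0 12); lia). lia.
      - rewrite mult_INR, pow_INR. replace (INR 5) with 5 by (simpl; ring).
        specialize (Hpoly n). nra. }
    replace (T + t + 4)%nat with (t + (T + 4))%nat by lia. rewrite plus_INR. lra.
Qed.

Theorem corollary4p3 :
  majority_QSETH ->
  forall delta : R, 0 < delta ->
  ~ exists A : com, solves_strong_simulation A 2 (exp_time delta).
Proof.
  intros HQ delta Hd (A & Hsol & Htime).
  destruct (HQ (Rmin delta 1 / 2)) as (c & Hc & HN).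
  - pose proof (Rmin_glb_lt delta 1 0). lra.
  - apply HN. exists (maj_com A). split.
    + now apply maj_com_solves.
    + now apply maj_com_time.
Qed.
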